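(* Let $p$ and $p'$ be positive coprime integers with $p'>p>2$, and let $r_0$ and $s_0$ be the smallest non-negative integers such that $|ps_0-p'r_0|=1$. If $p'/p$ has continued fraction $(e_0,e_1,\dots,e_{n-1},e_n+2)$, then $$\chi^{p,p'}_{r_0,s_0}=\sum\left(q^{\sum_{\mu=0}^n\sum_{i=1}^{e_\mu}\left(\lambda^{(\mu)}_i\right)^2}\frac1{(q)_{2\lambda^{(0)}_{e_0}}}\prod_{i=2}^{e_0}\frac1{(q)_{\lambda^{(0)}_{i-1}-\lambda^{(0)}_i}}\ \prod_{\mu=1}^n\ \prod_{i=1+\delta_{\mu,1}}^{e_\mu}\begin{bmatrix}2\left(w_\mu-\sum_{j=1}^i\lambda^{(\mu)}_j\right)+\lambda^{(\mu)}_{i-1}+\lambda^{(\mu)}_i\\ \lambda^{(\mu)}_{i-1}-\lambda^{(\mu)}_i\end{bmatrix}_q\right),$$ where the sum is over all sequences $\lambda^{(0)},\lambda^{(1)},\dots,\lambda^{(n)}$ of partitions such that, for $0\le\mu\le n$, the partition $\lambda^{(\mu)}=(\lambda^{(\mu)}_1,\dots,\lambda^{(\mu)}_{e_\mu})$ satisfies $\lambda^{(\mu)}_1\le\lambda^{(\mu)}_0$ (for $\mu>1$) and $wt(\lambda^{(\mu)})\le w_\mu$ (for $\mu>0$), where $w_\mu=\lambda^{(\mu-1)}_{e_{\mu-1}}$ for $1\le\mu\le n$, and $\lambda^{(\mu)}_0=w_{\mu-1}-wt(\lambda^{(\mu-1)})$ for $2\le\mu\le n$; and which additionally satisfy $w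t(\lambda^{(n)})=w_n$.
   Context: The identity is one of formal power series in $q$. Notation: $(q)_k=\prod_{i=1}^k(1-q^i)$, $(q)_\infty=\prod_{i\ge1}(1-q^i)$. The (normalised) Virasoro character is $$\chi^{p,p'}_{r,s}=\frac1{(q)_\infty}\sum_{\lambda=-\infty}^\infty\left(q^{\lambda^2pp'+\lambda(p'r-ps)}-q^{(\lambda p+r)(\lambda p'+s)}\right).$$ Gaussian polynomial: $\begin{bmatrix}A\\ B\end{bmatrix}_q=\frac{(q)_A}{(q)_B(q)_{A-B}}$ for $0\le B\le A$, and $0$ otherwise. Continued fraction: $p'/p$ has continued fraction $(c_0,\dots,c_n)$ if $p'/p=c_0+1/(c_1+1/(\cdots+1/c_n))$ with $c_0\ge0$, $c_i\ge1$ for $0<i<n$, $c_n\ge2$. Thus $e_\mu=c_\mu$ for $\mu<n$ and $e_n=c_n-2\ge0$. Here a partition $(\lambda_1,\dots,\lambda_e)$ is a weakly decreasing sequence of non-negative integers (zero parts allowed; empty if $e=0$) and $wt(\lambda)=\sum_i\lambda_i$; $\delta$ is the Kronecker delta. *)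

(* Defs.v *)
From HB Require Import structures.
From mathcomp Require Import all_boot all_order all_algebra.
From mathcomp Require Import zify ring lra.
From mathcomp Require Import boolp classical_sets functions cardinality fsbigop.

Set Implicit Arguments.
Unset Strict Implicit.
Unset Printing Implicit Defensive.

Import Order.TTheory GRing.Theory Num.Theory.

Local Open Scope ring_scope.
Local Open Scope classical_set_scope.

Record fps (R : Type) := Fps { fps_coef :> nat -> R }.

Lemma fpsP (R : Type) (f g : fps R) : f =1 g <-> f = g.
Proof. by case: f g => [f] [g]; split => [/= /funext ->|[->]]. Qed.

HB.instance Definition _ (R : Type) := gen_eqMixin (fps R).
HB.instance Definition _ (R : Type) := gen_choiceMixin (fps R).

Section Ring.
Variable R : comNzRingType.
Implicit Types f g h : fps R.

Definition fps_zero : fps R := Fps (fun=> 0).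
Definition fps_opp f := Fps (fun n => - f n).
Definition fps_add f g := Fps (fun n => f n + g n).
Definition fps_one : fps R := Fps (fun n => (n == 0%N)%:R).
Definition fps_mul f g := Fps (fun n => \sum_(i < n.+1) f i * g (n - i)%N).

Fact fps_addA : associative fps_add.
Proof. by move=> f g h; apply/fpsP => n /=; rewrite addrA. Qed.
Fact fps_addC : commutative fps_add.
Proof. by move=> f g; apply/fpsP => n /=; rewrite addrC. Qed.
Fact fps_add0 : left_id fps_zero fps_add.
Proof. by move=> f; apply/fpsP => n /=; rewrite add0r. Qed.
Fact fps_addN : left_inverse fps_zero fps_opp fps_add.
Proof. by move=> f; apply/fpsP => n /=; rewrite addNr. Qed.

HB.instance Definition _ :=
  GRing.isZmodule.Build (fps R) fps_addA fps_addC fps_add0 fps_addN.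

Definition fps_trunc f n : {poly R} := \poly_(i < n.+1) f i.

Lemma fps_mul_trunc f g n m : (m <= n)%N ->
  fps_mul f g m = (fps_trunc f n * fps_trunc g n)`_m.
Proof.
move=> le_mn; rewrite coefM; apply: eq_bigr => i _; rewrite !coef_poly.
by rewrite !ifT //; have := ltn_ord i; lia.
Qed.

Fact fps_mulA : associative fps_mul.
Proof.
move=> f g h; apply/fpsP => n.
transitivity ((fps_trunc f n * (fps_trunc g n * fps_trunc h n))`_n).
  rewrite coefM; apply: eq_bigr => i _; rewrite (@fps_mul_trunc g h n) ?leq_subr//.
  by rewrite coef_poly ltn_ord.
rewrite mulrA coefM; apply: eq_bigr => i _.
have le_in : (i <= n)%N by rewrite -ltnS ltn_ord.
by rewrite (@fps_mul_trunc f g n) // coef_poly ltnS leq_subr.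
Qed.

Fact fps_mulC : commutative fps_mul.
Proof.
by move=> f g; apply/fpsP => n; rewrite !(@fps_mul_trunc _ _ n)// mulrC.
Qed.

Fact fps_mul1 : left_id fps_one fps_mul.
Proof.
move=> f; apply/fpsP => n /=; rewrite big_ord_recl /= mul1r subn0 big1 ?addr0//.
by move=> i _; rewrite mul0r.
Qed.

Fact fps_mulDl : left_distributive fps_mul fps_add.
Proof.
move=> f g h; apply/fpsP => n /=; rewrite -big_split; apply: eq_bigr => i _.
by rewrite mulrDl.
Qed.

Fact fps_one_neq0 : fps_one != 0.
Proof. by apply/eqP => /fpsP /(_ 0%N) /= /eqP; rewrite oner_eq0. Qed.

HB.instance Definition _ := GRing.Zmodule_isComNzRing.Build (fps R)
  fps_mulA fps_mulC fps_mul1 fps_mulDl fps_one_neq0.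

Lemma fpsD f g n : (f + g) n = f n + g n. Proof. by []. Qed.
Lemma fpsN f n : (- f) n = - f n. Proof. by []. Qed.
Lemma fpsM f g n : (f * g) n = \sum_(i < n.+1) f i * g (n - i)%N.
Proof. by []. Qed.
Lemma fps1 n : (1 : fps R) n = (n == 0%N)%:R. Proof. by []. Qed.
Lemma fps0 n : (0 : fps R) n = 0. Proof. by []. Qed.

Definition fpsX : fps R := Fps (fun n => (n == 1%N)%:R).

Lemma fpsXM f n : (fpsX * f) n = if n is m.+1 then f m else 0.
Proof.
rewrite fpsM; case: n => [|n]; first by rewrite big_ord1 mul0r.
rewrite 2!big_ord_recl /= mul0r add0r mul1r subSS subn0 big1 ?addr0//.
by move=> i _; rewrite mul0r.
Qed.

Lemma fpsXnM k f n : (fpsX ^+ k * f) n = if (n < k)%N then 0 else f (n - k)%N.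
Proof.
elim: k n => [|k IH] n; first by rewrite expr0 mul1r subn0.
by rewrite exprS -mulrA fpsXM; case: n => // n; rewrite IH subSS ltnS.
Qed.

Lemma fpsXn k n : (fpsX ^+ k) n = (n == k)%:R.
Proof.
rewrite -[fpsX ^+ k]mulr1 fpsXnM fps1 subn_eq0.
by case: ltngtP.
Qed.

End Ring.
Arguments fpsX {R}.

Section Units.
Variable R : comUnitRingType.
Implicit Types f g : fps R.

(* The first n.+1 coefficients of 1 / f. *)
Fixpoint fps_inv_tab f n : seq R :=
  if n is m.+1 then
    let b := fps_inv_tab f m in
    rcons b (- (f 0%N)^-1 * \sum_(i < n) f (n - i)%N * b`_i)
  else [:: (f 0%N)^-1].

Definition fps_unit : {pred fps R} := fun f => f 0%N \is a GRing.unit.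

Definition fps_inv f : fps R :=
  if f \in fps_unit then Fps (fun n => (fps_inv_tab f n)`_n) else f.

Lemma size_fps_inv_tab f n : size (fps_inv_tab f n) = n.+1.
Proof. by elim: n => //= n IH; rewrite size_rcons IH. Qed.

Lemma nth_fps_inv_tab f n i : (i <= n)%N ->
  (fps_inv_tab f n)`_i = (fps_inv_tab f i)`_i.
Proof.
elim: n => [|n IH]; first by rewrite leqn0 => /eqP ->.
rewrite leq_eqVlt => /predU1P[->//|lt_in] /=.
by rewrite nth_rcons size_fps_inv_tab lt_in IH.
Qed.

Fact fps_mulVx : {in fps_unit, left_inverse 1 fps_inv *%R}.
Proof.
move=> f uf; apply/fpsP => n; rewrite /fps_inv uf fps1 fpsM /=.
move: uf; rewrite /fps_unit unfold_in => uf.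
case: n => [|n]; first by rewrite big_ord1 /= mulVr.
rewrite big_ord_recr /= subnn nth_rcons size_fps_inv_tab ltnn eqxx.
rewrite mulrAC mulNr mulVr // mulN1r.
apply/eqP; rewrite subr_eq0; apply/eqP; apply: eq_bigr => i _.
by rewrite mulrC (@nth_fps_inv_tab f n) // -ltnS ltn_ord.
Qed.

Fact fps_unitPl f g : g * f = 1 -> fps_unit f.
Proof.
move=> /fpsP /(_ 0%N); rewrite fpsM big_ord1 subnn fps1 /= => gf.
by rewrite /fps_unit; apply/unitrP; exists (g 0%N); rewrite gf mulrC gf.
Qed.

Fact fps_inv_out : {in [predC fps_unit], fps_inv =1 id}.
Proof. by move=> f; rewrite inE /fps_inv => /negbTE ->. Qed.

HB.instance Definition _ := GRing.ComNzRing_hasMulInverse.Build (fps R)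
  fps_mulVx fps_unitPl fps_inv_out.

Lemma fps_unitE f : (f \is a GRing.unit) = (f 0%N \is a GRing.unit).
Proof. by []. Qed.

End Units.

(* Each coefficient of the sum is a sum of finitely many nonzero terms; fsbigop
   makes a sum with infinite support 0, so [fps_sum] is meaningful only for a
   summable family. *)
Definition fps_summable (R : comNzRingType) (I : choiceType) (A : set I)
    (F : I -> fps R) : Prop :=
  forall n, finite_set [set i | A i /\ F i n != 0].

Definition fps_sum (R : comNzRingType) (I : choiceType) (A : set I)
    (F : I -> fps R) : fps R :=
  Fps (fun n => \sum_(i \in A) F i n).

Definition q : fps int := fpsX.

Definition qpoch (k : nat) : fps int := \prod_(1 <= i < k.+1) (1 - q ^+ i).

Lemma qpochS k : qpoch k.+1 = qpoch k * (1 - q ^+ k.+1).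
Proof. by rewrite /qpoch big_nat_recr. Qed.

(* The infinite product, as the coefficientwise limit of [qpoch]: see
   [qpoch_infE]. *)
Definition qpoch_inf : fps int := Fps (fun n => qpoch n n).

Lemma qpoch_infE n k : (n <= k)%N -> qpoch k n = qpoch_inf n.
Proof.
elim: k => [|k IH]; first by rewrite leqn0 => /eqP ->.
rewrite leq_eqVlt => /predU1P[->//|lt_nk]; rewrite -IH //.
rewrite qpochS mulrBr mulr1 fpsD fpsN [_ * q ^+ _]mulrC.
by rewrite fpsXnM lt_nk subr0.
Qed.

Lemma qpoch_coef0 k : qpoch k 0%N = 1.
Proof. by rewrite (@qpoch_infE 0) // -(@qpoch_infE 0 0) // /qpoch big_geq. Qed.

Lemma qpoch_unit k : qpoch k \is a GRing.unit.
Proof. by rewrite fps_unitE qpoch_coef0 unitr1. Qed.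

Lemma qpoch_inf_unit : qpoch_inf \is a GRing.unit.
Proof. by rewrite fps_unitE -(@qpoch_infE 0 0) // qpoch_coef0 unitr1. Qed.

Definition gauss (A B : nat) : fps int :=
  if (B <= A)%N then qpoch A / (qpoch B * qpoch (A - B)) else 0.

Section Virasoro.
Variables p p' r s : nat.

Definition chi_exp1 (l : int) : int :=
  l ^+ 2 * p%:Z * p'%:Z + l * (p'%:Z * r%:Z - p%:Z * s%:Z).

Definition chi_exp2 (l : int) : int :=
  (l * p%:Z + r%:Z) * (l * p'%:Z + s%:Z).

(* By [chi_exp_ge0] the exponents are nonnegative for the usual labels
   0 < r < p and 0 < s < p'; a negative power of the nonunit q is junk. *)
Definition chi_term (l : int) : fps int := q ^ chi_exp1 l - q ^ chi_exp2 l.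

Definition chi : fps int := qpoch_inf^-1 * fps_sum [set: int] chi_term.

Lemma chi_exp_ge0 l : (0 < r < p)%N -> (0 < s < p')%N ->
  0 <= chi_exp1 l /\ 0 <= chi_exp2 l.
Proof.
move=> /andP[r0 rp] /andP[s0 sp].
have [l0|l0] := lerP 0 l; rewrite /chi_exp1 /chi_exp2.
- split; last by apply: mulr_ge0; nia.
  have [->|l1] : l = 0 \/ 1 <= l by lia.
    by rewrite !mul0r.
  have -> : l ^+ 2 * p%:Z * p'%:Z + l * (p'%:Z * r%:Z - p%:Z * s%:Z) =
    l * ((l - 1) * (p%:Z * p'%:Z) + p%:Z * (p'%:Z - s%:Z) + p'%:Z * r%:Z).
    ring.
  apply: mulr_ge0 => //; apply: addr_ge0; last by nia.
  by apply: addr_ge0; apply: mulr_ge0; lia.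
- split; last by apply: mulr_le0; nia.
  have -> : l ^+ 2 * p%:Z * p'%:Z + l * (p'%:Z * r%:Z - p%:Z * s%:Z) =
    (- l) * ((- l - 1) * (p%:Z * p'%:Z) + p'%:Z * (p%:Z - r%:Z) + p%:Z * s%:Z).
    ring.
  apply: mulr_ge0; first by lia.
  apply: addr_ge0; last by nia.
  by apply: addr_ge0; apply: mulr_ge0; lia.
Qed.

End Virasoro.

Lemma finite_int_ball (N : nat) : finite_set [set l : int | (`|l| <= N)%N].
Proof.
apply: (@sub_finite_set _ _
  ((fun i : nat => i%:Z) @` `I_N.+1 `|` (fun i : nat => - i%:Z) @` `I_N.+1)).
  move=> l /= lN; case: (lerP 0 l) => l0; [left | right]; exists `|l|%N => //; lia.
by rewrite finite_setU; split; apply: finite_image; exact: finite_II.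
Qed.

Lemma qexpz_coef (k : int) n : (q ^ k) n != 0 -> n = `|k|%N.
Proof.
have qX m : (q ^+ m) n != 0 -> n = m.
  by rewrite fpsXn; case: (eqVneq n m) => // _; rewrite eqxx.
case: k => m; first exact: qX.
rewrite NegzE -exprnN invr_out; first exact: qX.
by rewrite fps_unitE exprS fpsXM unitr0.
Qed.

Lemma chi_summable p p' r s : (0 < p)%N -> (0 < p')%N ->
  fps_summable [set: int] (chi_term p p' r s).
Proof.
move=> p0 p'0 n.
pose M := (n + p' * r + p * s + r + s)%N.
apply: (sub_finite_set _ (finite_int_ball M)) => l [_ nz].
have : (q ^ chi_exp1 p p' r s l) n != 0 \/ (q ^ chi_exp2 p p' r s l) n != 0.
  have [z1|] := eqVneq ((q ^ chi_exp1 p p' r s l) n) 0; last by left.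
  have [z2|] := eqVneq ((q ^ chi_exp2 p p' r s l) n) 0; last by right.
  by move: nz; rewrite /chi_term fpsD fpsN z1 z2 subrr eqxx.
rewrite /= leqNgt; case=> /qexpz_coef nE; apply/negP => Ml.
- have : (`|(l * p%:Z * p'%:Z + (p'%:Z * r%:Z - p%:Z * s%:Z))%R|
     <= `|chi_exp1 p p' r s l|)%N.
    have -> : chi_exp1 p p' r s l =
        l * (l * p%:Z * p'%:Z + (p'%:Z * r%:Z - p%:Z * s%:Z)).
      by rewrite /chi_exp1; ring.
    by rewrite abszM leq_pmull //; lia.
  rewrite -nE; have : (`|l| <= `|(l * p%:Z * p'%:Z)%R|)%N.
    by rewrite !abszM -mulnA leq_pmulr // muln_gt0 p0 p'0.
  move: Ml; rewrite /M; clear; lia.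
- have : (`|(l * p%:Z + r%:Z)%R| <= `|chi_exp2 p p' r s l|)%N.
    rewrite abszM leq_pmulr //.
    have : (`|l| <= `|(l * p'%:Z)%R|)%N by rewrite abszM leq_pmulr.
    move: Ml; rewrite /M; clear; lia.
  rewrite -nE; have : (`|l| <= `|(l * p%:Z)%R|)%N by rewrite abszM leq_pmulr.
  move: Ml; rewrite /M; clear; lia.
Qed.

Fixpoint contfrac (c : seq nat) : rat :=
  match c with
  | [::] => 0
  | [:: a] => a%:R
  | a :: c' => a%:R + 1 / contfrac c'
  end.

Definition has_contfrac (x : rat) (c : seq nat) : Prop :=
  [/\ contfrac c = x, all (leq 1) (behead c) & (2 <= last 0 c)%N].

Definition bezout_pair (p p' r s : nat) : Prop :=
  `|p%:Z * s%:Z - p'%:Z * r%:Z| = 1.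

Definition least_bezout_pair (p p' r0 s0 : nat) : Prop :=
  bezout_pair p p' r0 s0 /\
  forall r s, bezout_pair p p' r s -> (r0 <= r)%N /\ (s0 <= s)%N.

(* A sequence of partitions is a list [l] of lists, [nth [::] l mu] being
   lambda^(mu); parts are numbered from 1, so lambda^(mu)_i is the entry of
   index i.-1. *)
Section Partitions.
Variables (n : nat) (e : nat -> nat) (l : seq (seq nat)).
Implicit Types mu i : nat.

Definition part mu : seq nat := nth [::] l mu.

Definition wt mu : nat := sumn (part mu).

(* The last part of lambda^(mu-1); used only for 1 <= mu <= n, where e mu.-1 > 0
   because p < p'. *)
Definition w mu : nat := nth 0%N (part mu.-1) (e mu.-1).-1.

(* lambda^(mu)_i, with the extra entry lambda^(mu)_0 used only for mu >= 2. *)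
Definition lam mu i : nat :=
  if i is j.+1 then nth 0%N (part mu) j else (w mu.-1 - wt mu.-1)%N.

Definition is_partition (k : nat) (s : seq nat) : bool :=
  (size s == k) && sorted geq s.

(* When e n = 0 the partition lambda^(n) is empty and lam n 1 is the default 0,
   so that the third condition is void at mu = n. *)
Definition admissible : Prop :=
  [/\ size l = n.+1,
      forall mu, (mu <= n)%N -> is_partition (e mu) (part mu),
      forall mu, (1 < mu <= n)%N -> (lam mu 1 <= lam mu 0)%N,
      forall mu, (0 < mu <= n)%N -> (wt mu <= w mu)%N
    & wt n = w n].

(* For admissible sequences no natural number subtraction here is truncated. *)
Definition summand : fps int :=
  q ^+ (\sum_(0 <= mu < n.+1) \sum_(1 <= i < (e mu).+1) lam mu i ^ 2)
  * (qpoch (2 * lam 0 (e 0)))^-1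
  * (\prod_(2 <= i < (e 0).+1) (qpoch (lam 0 i.-1 - lam 0 i))^-1)
  * \prod_(1 <= mu < n.+1) \prod_(1 + (mu == 1) <= i < (e mu).+1)
      gauss (2 * (w mu - \sum_(1 <= j < i.+1) lam mu j) + lam mu i.-1 + lam mu i)
            (lam mu i.-1 - lam mu i).

End Partitions.

Lemma finite_seq_le (T : Type) (A : set T) k : finite_set A ->
  finite_set [set s : seq T | (size s <= k)%N /\
    forall x0 i, (i < size s)%N -> A (nth x0 s i)].
Proof.
move=> finA; elim: k => [|k IH].
  by apply: (@sub_finite_set _ _ [set [::]]) => [[|x s] [] //|]; exact: finite_set1.
apply: (@sub_finite_set _ _ ([set [::]] `|` [set x :: s | x in A & s in
   [set s : seq T | (size s <= k)%N /\
     forall x0 i, (i < size s)%N -> A (nth x0 s i)]])).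
  move=> [|x s] [/= szs As]; [by left|right].
  exists x; first exact: (As x 0%N).
  by exists s => //; split => // x0 i; exact: (As x0 i.+1).
by rewrite finite_setU; split; [exact: finite_set1|exact: finite_image2].
Qed.

Lemma summand_summable n e :
  fps_summable [set l | admissible n e l] (summand n e).
Proof.
move=> N; pose M := (\max_(mu < n.+1) e mu)%N.
pose A := [set s : seq nat | (size s <= M)%N /\
  forall x0 i, (i < size s)%N -> `I_N.+1 (nth x0 s i)].
have finA : finite_set A by apply: finite_seq_le; exact: finite_II.
apply: (sub_finite_set _ (finite_seq_le n.+1 finA)) => l [[szl lP _ _ _] nz].
split=> [|s0 mu]; rewrite szl // => lt_mu.
have -> : nth s0 l mu = part l mu by apply: set_nth_default; rewrite szl.
have /andP[/eqP sz_mu _] := lP mu lt_mu.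
split; first by rewrite sz_mu; exact: (@leq_bigmax _ (fun m : 'I_n.+1 => e m) (Ordinal lt_mu)).
move=> x0 i; rewrite sz_mu => lt_i; rewrite /= ltnS.
have -> : nth x0 (part l mu) i = lam e l mu i.+1.
  by rewrite /lam; apply: set_nth_default; rewrite sz_mu.
move: nz; rewrite /summand -!mulrA fpsXnM; case: ltnP => [_|le_N _].
  by rewrite eqxx.
apply: leq_trans le_N.
rewrite (bigD1_seq mu) ?iota_uniq ?mem_index_iota //=.
apply: leq_trans (leq_addr _ _).
rewrite (bigD1_seq i.+1) ?iota_uniq ?mem_index_iota ?ltnS ?lt_i //=.
apply: leq_trans (leq_addr _ _).
by rewrite -mulnn; case: (nth _ _ _) => // m; rewrite leq_pmulr.
Qed.

(* Main.v *)
(* Burge's transform sends f to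
     (T f)(L, M) = sum_x q^(x^2) [2L + M - x; M - x] f(L - x, x).
   On the products B(L, M, a, b) = [L+M+a-b; L+a] [L+M-a+b; L-a] with a b >= 0
   it acts by T B(a, b) = q^(b^2) B(a + b, b), a consequence of the q-Vandermonde
   sum. Hence T sends the doubly bounded analogue of the character with labels
   p, p', r, s, which is obtained by attaching B(p'l, pl) and B(p'l+s, pl+r) to
   the terms of chi, to the one with labels p, p + p', r, r + s. Exchanging L and M
   exchanges p with p' and r with s. These two moves carry out the continued
   fraction algorithm, starting from the labels 1, 1, 0, 1, where the polynomial
   telescopes to 1 if L = M = 0 and to 0 otherwise. The product of all these
   transforms is a sum over the sequences of partitions in the theorem, and the
   identity is its limit for L, M -> infinity. *)
Require Import Defs.
From mathcomp Require Import all_boot all_order all_algebra.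
From mathcomp Require Import zify ring lra.
From mathcomp Require Import boolp classical_sets fsbigop.

Set Implicit Arguments.
Unset Strict Implicit.
Unset Printing Implicit Defensive.

Import Order.TTheory GRing.Theory Num.Theory.

Local Open Scope ring_scope.
Local Open Scope classical_set_scope.

(** * Gaussian polynomials *)

Lemma gaussE a b : gauss (a + b) a = qpoch (a + b) / (qpoch a * qpoch b).
Proof. by rewrite /gauss leq_addr addKn. Qed.

Lemma gauss_gt n k : (n < k)%N -> gauss n k = 0.
Proof. by move=> ltnk; rewrite /gauss leqNgt ltnk. Qed.

Lemma gaussK a b : gauss (a + b) a * (qpoch a * qpoch b) = qpoch (a + b).
Proof. by rewrite gaussE divrK // unitrM !qpoch_unit. Qed.

Lemma gauss0 n : gauss n 0 = 1.
Proof. by rewrite /gauss leq0n subn0 {2}/qpoch big_geq // mul1r divrr // qpoch_unit. Qed.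

Lemma gauss_sym n k : (k <= n)%N -> gauss n (n - k) = gauss n k.
Proof. by move=> lekn; rewrite /gauss leq_subr lekn subKn // [_ * qpoch k]mulrC. Qed.

Lemma gaussnn n : gauss n n = 1.
Proof. by rewrite -{2}[n]subn0 gauss_sym // gauss0. Qed.

(** Both products equal the q-trinomial coefficient [qpoch (a + b + c) / (qpoch a * qpoch b * qpoch
    c)]. *)
Lemma gauss_trinom a b c :
  gauss (a + b + c) a * gauss (b + c) b = gauss (a + b + c) (a + b) * gauss (a + b) a.
Proof.
apply: (@mulIr _ (qpoch a * (qpoch b * qpoch c) * (qpoch (b + c) * qpoch (a + b)))).
  by rewrite !unitrM !qpoch_unit.
have e1 := gaussK a (b + c); have e2 := gaussK b c.
have e3 := gaussK (a + b) c; have e4 := gaussK a b.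
rewrite addnA in e1.
transitivity (qpoch (a + b + c) * qpoch (b + c) * qpoch (a + b)).
  by rewrite -e1 -[X in _ = _ * X * _]e2; ring.
by rewrite -{1}e3 -[X in _ * X = _]e4; ring.
Qed.

Lemma gaussS n k : gauss n.+1 k.+1 = gauss n k.+1 + q ^+ (n - k) * gauss n k.
Proof.
case: (ltngtP k n) => [ltkn|gtkn|->]; last first.
- by rewrite !gaussnn gauss_gt // subnn add0r mulr1.
- by rewrite !gauss_gt ?ltnS // ?mulr0 ?addr0 // ltnW.
have [c ->] : exists c, n = (k + c.+1)%N by exists (n - k.+1)%N; lia.
rewrite addKn.
apply: (@mulIr _ (qpoch k.+1 * qpoch c.+1)); first by rewrite unitrM !qpoch_unit.
have e1 := gaussK k.+1 c.+1; have e2 := gaussK k.+1 c; have e3 := gaussK k c.+1.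
rewrite addSn in e1; rewrite e1 mulrDl.
have -> : gauss (k + c.+1) k.+1 * (qpoch k.+1 * qpoch c.+1) = qpoch (k + c.+1) * (1 - q ^+ c.+1).
  by rewrite -addSnnS -e2 [qpoch c.+1]qpochS; ring.
have -> : q ^+ c.+1 * gauss (k + c.+1) k * (qpoch k.+1 * qpoch c.+1) =
    q ^+ c.+1 * (qpoch (k + c.+1) * (1 - q ^+ k.+1)).
  by rewrite -e3 (qpochS k); ring.
by rewrite qpochS -addSn exprD; ring.
Qed.

Lemma q_vandermonde m n k :
  gauss (m + n) k =
  \sum_(j < k.+1) q ^+ (j * (m - (k - j))) * gauss m (k - j) * gauss n j.
Proof.
elim: n k => [|n IHn] k.
  rewrite addn0 big_ord_recl gauss0 subn0 mul0n mul1r mulr1 big1 ?addr0 // => i _.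
  by rewrite [gauss 0 _]gauss_gt // mulr0.
case: k => [|k].
  by rewrite big_ord1 !gauss0 !mulr1.
rewrite addnS gaussS !IHn [in RHS]big_ord_recl [X in X + _]big_ord_recl -addrA !gauss0.
congr (_ + _).
rewrite mulr_sumr -big_split; apply: eq_bigr => -[j ltjk] _ /=.
rewrite /bump /= add1n subSS gaussS mulrDr; congr (_ + _).
(* Outside [k - j <= m], [j <= n] a Gaussian vanishes; inside, no subtraction in the exponents
   truncates. *)
case: (ltnP m (k - j)) => [lt1|le1]; first by rewrite gauss_gt // !(mulr0, mul0r).
case: (ltnP n j) => [lt2|le2]; first by rewrite (@gauss_gt n j) // !(mulr0, mul0r).
rewrite [RHS]mulrACA -exprD !mulrA -exprD; congr (q ^+ _ * _ * _); nia.
Qed.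

Lemma q_vandermonde_shift m n c :
  gauss (m + n) (c + n) =
  \sum_(k < n.+1) q ^+ ((n - k) * (m - (k + c))) * gauss m (k + c) * gauss n k.
Proof.
rewrite q_vandermonde addnC -addSn big_split_ord /= [X in _ + X]big1 ?addr0; last first.
  by move=> i _; rewrite [gauss n _]gauss_gt ?mulr0 // addSn ltnS leq_addr.
rewrite (reindex_inj rev_ord_inj); apply: eq_bigr => -[k ltkn] _ /=.
have lekn : (k <= n)%N by [].
rewrite subSS gauss_sym //.
by have -> : (n + c - (n - k) = k + c)%N by lia.
Qed.

Lemma sum_triangle (V : nmodType) (F : nat -> nat -> V) m :
  \sum_(k < m.+1) \sum_(j < (m - k).+1) F k (k + j)%N =
  \sum_(l < m.+1) \sum_(k < l.+1) F k l.
Proof.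
elim: m => [|m IHm]; first by rewrite !big_ord1.
rewrite big_ord_recr subnn big_ord1 addn0 [RHS]big_ord_recr -IHm.
rewrite [X in _ = _ + X]big_ord_recr addrA -big_split; congr (_ + _).
apply: eq_bigr => -[k ltkm] _ /=.
by rewrite subSn // big_ord_recr /= addnS subnKC.
Qed.

(** A form of the q-Saalschuetz sum. Vandermonde expands the first Gaussian over [j]; the trinomial
    relation turns [[A; k] [A - k; j]] into [[A; l] [l; k]] with [l = k + j]. The sum over [k] is
    then a Vandermonde sum, and after one more trinomial exchange so is the sum over [l]. *)
Lemma burge_sum A B m c :
  \sum_(k < m.+1) q ^+ (k * (k + c)) * gauss (A + B + m - k) (m - k)
     * gauss A k * gauss B (k + c)
  = gauss (m + A + c) m * gauss (m + B) (m + c).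
Proof.
case: (ltnP B c) => [ltBc|lecB].
  rewrite [gauss (m + B) _]gauss_gt ?ltn_add2l // mulr0 big1 // => k _.
  by rewrite [gauss B _]gauss_gt ?mulr0 //; lia.
transitivity (\sum_(l < m.+1) q ^+ (l * (l + c)) * gauss A l *
   (gauss (B + m) (m - l) * gauss (B + l) (c + l))).
  transitivity (\sum_(l < m.+1) \sum_(k < l.+1)
     gauss A l * gauss (B + m) (m - l) *
     (q ^+ (k * (k + c) + (l - k) * (B + l)) * gauss l k * gauss B (k + c))).
    rewrite -(sum_triangle (fun k l => gauss A l * gauss (B + m) (m - l) *
     (q ^+ (k * (k + c) + (l - k) * (B + l)) * gauss l k * gauss B (k + c)))).
    apply: eq_bigr => -[k ltkm] _ /=.
    have lekm : (k <= m)%N by [].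
    case: (ltnP A k) => [ltAk|leAk].
      rewrite [gauss A k]gauss_gt // mulr0 mul0r big1 // => -[j _] _ /=.
      by rewrite [gauss A _]gauss_gt ?mul0r //; exact: leq_trans ltAk (leq_addr _ _).
    have -> : (A + B + m - k = B + m + (A - k))%N by lia.
    rewrite q_vandermonde mulr_sumr !mulr_suml.
    apply: eq_bigr => -[j ltjm] _ /=.
    case: (ltnP (A - k) j) => [lt1|le1].
      rewrite [gauss _ j]gauss_gt // [gauss A (k + j)]gauss_gt ?(mulr0, mul0r) //; lia.
    have := gauss_trinom k j (A - k - j).
    have -> : (k + j + (A - k - j))%N = A by lia.
    have -> : (j + (A - k - j))%N = (A - k)%N by lia.
    move=> e1; rewrite -subnDA.
    have -> : (k * (k + c) + (k + j - k) * (B + (k + j)) =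
      k * (k + c) + j * (B + m - (m - (k + j))))%N.
      congr (_ + _ * _)%N; lia.
    transitivity (q ^+ (k * (k + c)) * q ^+ (j * (B + m - (m - (k + j)))) *
        gauss (B + m) (m - (k + j)) * (gauss A k * gauss (A - k) j) * gauss B (k + c)); first by ring.
    by rewrite e1 exprD; ring.
  apply: eq_bigr => -[l ltlm] _ /=.
  rewrite -mulr_sumr.
  transitivity (gauss A l * gauss (B + m) (m - l) *
    (q ^+ (l * (l + c)) * gauss (B + l) (c + l))); last by ring.
  congr (_ * _).
  rewrite q_vandermonde_shift mulr_sumr; apply: eq_bigr => -[k ltkl] _ /=.
  case: (ltnP B (k + c)) => [lt1|le1].
    by rewrite [gauss B _]gauss_gt ?(mulr0, mul0r).
  rewrite !mulrA -exprD mulrAC.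
  by congr (q ^+ _ * _ * _); nia.
rewrite [X in _ = X * _](_ : _ = gauss (m + c + A) m); last by congr gauss; lia.
rewrite q_vandermonde mulr_suml; apply: eq_bigr => -[l ltlm] _ /=.
have le_lm : (l <= m)%N by [].
have := gauss_trinom (m - l) (c + l) (B - c).
have -> : (m - l + (c + l) + (B - c))%N = (m + B)%N by lia.
have -> : (m - l + (c + l))%N = (m + c)%N by lia.
have -> : (c + l + (B - c))%N = (B + l)%N by lia.
have -> : (m + c - (m - l))%N = (l + c)%N by lia.
rewrite [(B + m)%N]addnC => ->; ring.
Qed.

(** * The Burge transform and bosonic polynomials *)

(** Integer arguments avoid truncated subtraction, and the value 0 outside [0 <= k <= A] encodes the
    ranges of summation. *)
Definition gaussz (A k : int) : fps int :=
  if 0 <= k <= A then gauss `|A|%N `|k|%N else 0.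

Lemma gaussz_nat (n k : nat) : gaussz n%:Z k%:Z = gauss n k.
Proof.
rewrite /gaussz lez_nat le0z_nat /=.
by case: leqP => // ltnk; rewrite gauss_gt.
Qed.

Lemma gaussz_out A k : ~~ (0 <= k <= A) -> gaussz A k = 0.
Proof. by rewrite /gaussz => /negbTE ->. Qed.

Lemma gaussz_sym A k : gaussz A (A - k) = gaussz A k.
Proof.
have [/andP[k0 kA]|nk] := boolP (0 <= k <= A); last first.
  by rewrite !gaussz_out //; lia.
case: k k0 kA => // k _ kA; case: A kA => // A kA.
have lekA : (k <= A)%N by lia.
have -> : A%:Z - k%:Z = (A - k)%N%:Z by lia.
by rewrite !gaussz_nat gauss_sym.
Qed.

(** The assumption excludes [A = k = -1], where the left side is [[0; 0] = 1] and the right side is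
    0. *)
Lemma gausszS A k : 0 <= A ->
  gaussz (A + 1) (k + 1) = gaussz A (k + 1) + q ^+ `|A - k|%N * gaussz A k.
Proof.
case: A => // n _.
case: k => [k|[|k]].
- have -> : n%:Z + 1 = n.+1%:Z by lia.
  have -> : k%:Z + 1 = k.+1%:Z by lia.
  rewrite !gaussz_nat gaussS.
  case: (leqP k n) => [le|lt]; last by rewrite [gauss n k]gauss_gt // !mulr0.
  by have -> : (n - k = `|n%:Z - k%:Z|)%N by lia.
- have -> : n%:Z + 1 = n.+1%:Z by lia.
  by rewrite [gaussz _ (Negz 0)]gaussz_out // mulr0 addr0 !gaussz_nat !gauss0.
- by rewrite !gaussz_out ?mulr0 ?addr0 //; lia.
Qed.

(* Nonzero only for |a| <= L and |b| <= M. *)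
Definition bprod (L M : nat) (a b : int) : fps int :=
  gaussz (L%:Z + M%:Z + a - b) (L%:Z + a) * gaussz (L%:Z + M%:Z - a + b) (L%:Z - a).

Lemma bprodN L M a b : bprod L M (- a) (- b) = bprod L M a b.
Proof. by rewrite /bprod !opprK mulrC. Qed.

Lemma bprodC L M a b : bprod M L b a = bprod L M a b.
Proof.
rewrite /bprod mulrC; congr (_ * _).
- rewrite -[RHS]gaussz_sym; congr gaussz; lia.
- rewrite -[RHS]gaussz_sym; congr gaussz; lia.
Qed.

(** The limit [minn L M] keeps [L - x] and [M - x] from truncating. *)
Definition burge (f : nat -> nat -> fps int) (L M : nat) : fps int :=
  \sum_(x < (minn L M).+1)
    q ^+ (x ^ 2) * gauss (2 * (L - x) + M + x) (M - x) * f (L - x)%N x.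

Lemma burge_bprod_nat L M (a b : nat) :
  burge (fun L M => bprod L M a b) L M = q ^+ (b ^ 2) * bprod L M (a%:Z + b%:Z) b.
Proof.
have [/andP[leL leM]|nle] := boolP ((a + b <= L) && (b <= M))%N; last first.
  rewrite /burge big1 => [|[x ltx] _ /=].
    rewrite /bprod; case: (leqP (a + b) L) nle => [le nle|lt _].
      by rewrite gaussz_out ?(mul0r, mulr0) //; lia.
    by rewrite [X in _ * (_ * X)]gaussz_out ?(mul0r, mulr0) //; lia.
  case: (ltnP x b) => [ltxb|lebx].
    by rewrite /bprod gaussz_out ?(mul0r, mulr0) //; lia.
  by rewrite /bprod [X in _ * (_ * X)]gaussz_out ?(mul0r, mulr0) //; lia.
have [u def_L] : exists u, (L = a + b + u)%N by exists (L - (a + b))%N; lia.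
have [m def_M] : exists m, (M = b + m)%N by exists (M - b)%N; lia.
(* With [x = b + k], [A] and [B] are the upper entries [L + a - b] and [L - a + b] of the two
   factors of [bprod]; reflecting the lower entries gives [k] and [k + 2b], whence [c]. *)
pose A := (a + a + u)%N; pose B := (b + b + u)%N; pose c := (b + b)%N.
pose F k := q ^+ (k * (k + c)) * gauss (A + B + m - k) (m - k) * gauss A k * gauss B (k + c).
transitivity (q ^+ (b ^ 2) * \sum_(k < m.+1) F k); last first.
  rewrite burge_sum; congr (_ * _); rewrite /bprod -!gaussz_nat; congr (_ * _).
    rewrite -[RHS]gaussz_sym; congr gaussz; lia.
  rewrite -[RHS]gaussz_sym; congr gaussz; lia.
pose T x := q ^+ (x ^ 2) * gauss (2 * (L - x) + M + x) (M - x) * bprod (L - x) x a b.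
rewrite /burge -(big_mkord xpredT T) -(big_mkord xpredT F).
have le1 : (b <= (minn L M).+1)%N by lia.
(* The terms with [x < b] vanish; so do the terms of [F] beyond the range of [x], where
   [k + c > B]. *)
rewrite (@big_cat_nat _ _ _ b) //= [X in X + _]big1_seq ?add0r; last first.
  move=> x; rewrite mem_index_iota => /= ltxb.
  by rewrite /T /bprod gaussz_out ?(mul0r, mulr0) //; lia.
have le2 : ((minn L M).+1 - b <= m.+1)%N by lia.
rewrite [in RHS](@big_cat_nat _ _ _ _ _ _ _ _ _ le2) //=
  [X in _ * (_ + X)]big1_seq ?addr0; last first.
  move=> k; rewrite mem_index_iota => /= ltk.
  by rewrite /F [gauss B _]gauss_gt ?mulr0 //; lia.
rewrite -{1}[b]add0n big_addn mulr_sumr; apply: eq_big_nat => k ltk.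
rewrite /T /F /bprod !mulrA.
have -> : (q ^+ (b ^ 2) * q ^+ (k * (k + c)) = q ^+ ((k + b) ^ 2)).
  by rewrite -exprD; congr (q ^+ _); rewrite /c; nia.
congr (_ * _ * _ * _).
- by congr gauss; lia.
- rewrite -gaussz_nat -gaussz_sym; congr gaussz; lia.
- rewrite -gaussz_nat -gaussz_sym; congr gaussz; lia.
Qed.

(** Only the pairs [(L - x, x)] are evaluated, and their sum is [L]; so a bound on [L + M] survives
    each transform. *)
Lemma eq_burge f g L M : (forall L' M', (L' + M' <= L)%N -> f L' M' = g L' M') ->
  burge f L M = burge g L M.
Proof.
by move=> fg; apply: eq_bigr => -[x ltx] _ /=; rewrite fg //; lia.
Qed.

Lemma burge_bprodz L M (a b : int) : (0 <= a /\ 0 <= b) \/ (a <= 0 /\ b <= 0) ->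
  burge (fun L M => bprod L M a b) L M = q ^+ (`|b| ^ 2)%N * bprod L M (a + b) b.
Proof.
case=> [[]|[]].
  by case: a => // a _; case: b => // b _; exact: burge_bprod_nat.
move=> a0 b0; have [a' def_a] : exists a' : nat, a = - a'%:Z by exists `|a|%N; lia.
have [b' def_b] : exists b' : nat, b = - b'%:Z by exists `|b|%N; lia.
rewrite def_a def_b -opprD bprodN abszN /= -burge_bprod_nat.
by apply: eq_burge => L' M' _; rewrite bprodN.
Qed.

(** The cutoff is symmetric, so that [l] may be replaced by [-l], and independent of [L] and [M], so
    that it passes unchanged through [burge]. *)
Definition zsum (B : nat) (F : int -> fps int) : fps int :=
  \sum_(i < (2 * B).+1) F (i%:Z - B%:Z).

Lemma eq_zsum B F G : F =1 G -> zsum B F = zsum B G.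
Proof. by move=> FG; apply: eq_bigr => i _; rewrite FG. Qed.

Lemma zsumB B F G : zsum B (fun l => F l - G l) = zsum B F - zsum B G.
Proof. exact: sumrB. Qed.

Lemma zsumN B F : zsum B (fun l => F (- l)) = zsum B F.
Proof.
rewrite /zsum (reindex_inj rev_ord_inj); apply: eq_bigr => -[i lti] _ /=.
congr F; lia.
Qed.

Lemma zsum_telescope B G : zsum B (fun l => G (l + 1) - G l) = G (B%:Z + 1) - G (- B%:Z).
Proof.
rewrite /zsum.
rewrite -(big_mkord xpredT (fun i => G (i%:Z - B%:Z + 1) - G (i%:Z - B%:Z))).
rewrite (eq_bigr (fun i : nat => G (i.+1%:Z - B%:Z) - G (i%:Z - B%:Z))) => [|i _]; last first.
  by congr (G _ - _); lia.
rewrite telescope_sumr //; congr (G _ - G _); lia.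
Qed.

Section BosonicPolynomial.
Variables p p' r s : nat.

Definition bose_term1 (L M : nat) (l : int) : fps int :=
  q ^+ `|chi_exp1 p p' r s l|%N * bprod L M (l * p'%:Z) (l * p%:Z).

Definition bose_term2 (L M : nat) (l : int) : fps int :=
  q ^+ `|chi_exp2 p p' r s l|%N * bprod L M (l * p'%:Z + s%:Z) (l * p%:Z + r%:Z).

Definition bose (B L M : nat) : fps int :=
  zsum B (fun l => bose_term1 L M l - bose_term2 L M l).

End BosonicPolynomial.

(** Only the first sum is reflected: [chi_exp1] is invariant under the exchange of labels combined
    with [l -> -l], [chi_exp2] under the exchange alone. *)
Lemma bose_swap p p' r s B L M : bose p' p s r B L M = bose p p' r s B M L.
Proof.
rewrite /bose !zsumB -[in LHS]zsumN; congr (_ - _); apply: eq_zsum => l.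
- rewrite /bose_term1 !mulNr bprodN bprodC; congr (q ^+ `|_|%N * _).
  by rewrite /chi_exp1; ring.
- by rewrite /bose_term2 bprodC; congr (q ^+ `|_|%N * _); rewrite /chi_exp2 mulrC.
Qed.

Lemma burge_zsum B (F : int -> nat -> nat -> fps int) L M :
  burge (fun L M => zsum B (fun l => F l L M)) L M = zsum B (fun l => burge (F l) L M).
Proof.
by rewrite /burge /zsum exchange_big; apply: eq_bigr => x _; rewrite mulr_sumr.
Qed.

Lemma burgeB f g L M : burge (fun L M => f L M - g L M) L M = burge f L M - burge g L M.
Proof. by rewrite /burge -sumrB; apply: eq_bigr => x _; rewrite mulrBr. Qed.

Lemma burgeZ c f L M : burge (fun L M => c * f L M) L M = c * burge f L M.
Proof. by rewrite /burge mulr_sumr; apply: eq_bigr => x _; rewrite mulrCA. Qed.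

(** [chi_exp_ge0] does not cover the starting labels 1, 1, 0, 1. Here the Bezout condition makes the
    exponent [p p' l^2 + l] or [p p' l^2 - l]. *)
Lemma chi_exp1_ge0 p p' r s l :
  `|p'%:Z * r%:Z - p%:Z * s%:Z| = 1 -> (0 < p)%N -> (0 < p')%N -> 0 <= chi_exp1 p p' r s l.
Proof.
move=> bez p0 p'0; rewrite /chi_exp1.
have : 1 <= p%:Z * p'%:Z by nia.
rewrite -mulrA; move: (p%:Z * p'%:Z) => u u1.
have [->|->] : p'%:Z * r%:Z - p%:Z * s%:Z = 1 \/ p'%:Z * r%:Z - p%:Z * s%:Z = -1 by lia.
  nia.
nia.
Qed.

(** Provides the sign condition of [burge_bprodz]: both expressions are nonnegative for [l >= 0] and
    nonpositive for [l <= -1]. *)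
Lemma chi_exp2_sign p p' r s l : (r <= p)%N -> (s <= p')%N ->
  (0 <= l * p'%:Z + s%:Z /\ 0 <= l * p%:Z + r%:Z) \/
  (l * p'%:Z + s%:Z <= 0 /\ l * p%:Z + r%:Z <= 0).
Proof.
move=> lerp lesp'; have [l0|l0] := lerP 0 l; first by left; nia.
by right; nia.
Qed.

Lemma chi_exp2_ge0 p p' r s l : (r <= p)%N -> (s <= p')%N -> 0 <= chi_exp2 p p' r s l.
Proof.
rewrite /chi_exp2 => lerp lesp'.
case: (chi_exp2_sign l lerp lesp') => [[h1 h2]|[h1 h2]]; first exact: mulr_ge0.
exact: mulr_le0.
Qed.

(** The powers [q^((l p)^2)] and [q^((l p + r)^2)] produced by [burge_bprodz] are exactly the growth
    of the two exponents under the change of labels. *)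
Lemma burge_bose p p' r s B L M :
  `|p'%:Z * r%:Z - p%:Z * s%:Z| = 1 -> (0 < p)%N -> (0 < p')%N -> (r <= p)%N -> (s <= p')%N ->
  burge (bose p p' r s B) L M = bose p (p + p') r (r + s) B L M.
Proof.
move=> bez p0 p'0 lerp lesp'; rewrite burge_zsum; apply: eq_zsum => l.
rewrite burgeB /bose_term1 /bose_term2 !burgeZ; congr (_ - _).
- rewrite burge_bprodz; last by nia.
  rewrite mulrA -exprD; congr (q ^+ _ * bprod _ _ _ _); last by lia.
  have := chi_exp1_ge0 l bez p0 p'0.
  have -> : chi_exp1 p (p + p') r (r + s) l = chi_exp1 p p' r s l + (l * p%:Z) ^+ 2.
    by rewrite /chi_exp1 !PoszD; ring.
  by nia.
- rewrite burge_bprodz; last exact: chi_exp2_sign.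
  rewrite mulrA -exprD; congr (q ^+ _ * bprod _ _ _ _); last by lia.
  have := chi_exp2_ge0 l lerp lesp'.
  have -> : chi_exp2 p (p + p') r (r + s) l = chi_exp2 p p' r s l + (l * p%:Z + r%:Z) ^+ 2.
    by rewrite /chi_exp2 !PoszD; ring.
  by nia.
Qed.

(* With [N := L + M] and [G l := - q^(l^2 - l) [N; L+l] [N-1; L-l]], Pascal's
   rule turns the [l]-th term into [G (l + 1) - G l]. *)
Lemma bose11 B L M : (L + M < B)%N -> bose 1 1 0 1 B L M = ((L == 0) && (M == 0))%N%:R.
Proof.
move=> ltB; have [/andP[/eqP -> /eqP ->]|nz] := boolP ((L == 0) && (M == 0))%N.
  have ltB2 : (B < (2 * B).+1)%N by lia.
  rewrite /bose /zsum (bigD1 (Ordinal ltB2)) //= big1 ?addr0 => [|[i lti] neqiB].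
    rewrite subrr /bose_term1 /bose_term2 /bprod [X in _ - _ * (_ * X)]gaussz_out //.
    by rewrite !mulr0 subr0 !mul0r (gaussz_nat 0 0) gauss0 !mulr1.
  rewrite -val_eqE /= in neqiB; rewrite /bose_term1 /bose_term2 /bprod /=.
  rewrite [X in _ * X - _](_ : _ = 0); last first.
    case: (ltnP i B) => [lt|le].
      by rewrite [X in X * _]gaussz_out ?mul0r //; lia.
    by rewrite [X in _ * X]gaussz_out ?mulr0 //; lia.
  by rewrite [X in _ - _ * (_ * X)]gaussz_out ?mulr0 ?subr0 //; lia.
pose N : int := L%:Z + M%:Z.
pose G (l : int) := - (q ^+ absz (l ^+ 2 - l)%R *
  (gaussz N (L%:Z + l) * gaussz (N - 1) (L%:Z - l))).
transitivity (zsum B (fun l => G (l + 1) - G l)).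
  apply: eq_zsum => l; rewrite /bose_term1 /bose_term2 /chi_exp1 /chi_exp2 /bprod /G.
  rewrite !mulr1 mulr0 sub0r addr0.
  have -> : l ^+ 2 + l * - 1%:Z = l ^+ 2 - l by ring.
  have -> : l * (l + 1) = (l + 1) ^+ 2 - (l + 1) by ring.
  have -> : L%:Z + M%:Z + l - l = N by rewrite /N; lia.
  have -> : L%:Z + M%:Z - l + l = N by rewrite /N; lia.
  have -> : L%:Z + M%:Z + (l + 1) - l = N + 1 by rewrite /N; lia.
  have -> : L%:Z + M%:Z - (l + 1) + l = N - 1 by rewrite /N; lia.
  (* Pascal's rule splits the second factor of the first product and the first factor of the second;
     [0 <= N - 1] because [L] and [M] are not both 0. *)
  have := @gausszS (N - 1) (L%:Z - l - 1); rewrite !subrK => ->; last by rewrite /N; lia.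
  rewrite [L%:Z + (l + 1)]addrA [in gaussz (N + 1) _]gausszS; last by rewrite /N; lia.
  have -> : L%:Z - (l + 1) = L%:Z - l - 1 by ring.
  set g1 := gaussz N (L%:Z + l); set g2 := gaussz (N - 1) (L%:Z - l - 1).
  (* The mixed terms cancel: where they do not vanish, both exponents are [l^2 + M]. *)
  have /eqP : q ^+ absz (l ^+ 2 - l)%R * q ^+ absz (N - 1 - (L%:Z - l - 1))%R * (g1 * g2) =
         q ^+ absz ((l + 1) ^+ 2 - (l + 1))%R * q ^+ absz (N - (L%:Z + l))%R * (g1 * g2).
    have [z1|nz1] := boolP (0 <= L%:Z + l <= N); last by rewrite /g1 gaussz_out // !(mul0r, mulr0).
    have [z2|nz2] := boolP (0 <= L%:Z - l - 1 <= N - 1);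
      last by rewrite /g2 gaussz_out // !(mul0r, mulr0).
    rewrite -!exprD; congr (q ^+ _ * _).
    rewrite /N in z1 z2 *; nia.
  rewrite -subr_eq0 => /eqP e.
  by apply/eqP; rewrite -subr_eq0 -[X in _ == X]e; apply/eqP; ring.
rewrite zsum_telescope /G.
rewrite [gaussz _ (L%:Z + (B%:Z + 1))]gaussz_out; last by rewrite /N; lia.
rewrite [gaussz _ (L%:Z + (- B%:Z))]gaussz_out; last by rewrite /N; lia.
by rewrite !(mul0r, mulr0) subrr.
Qed.

(** * Continued fractions and labels *)

(* The base case stands for the labels 2, 1, 1, 0, whose continued fraction is 1/2. *)
Fixpoint fermi (es : seq nat) (L M : nat) : fps int :=
  if es is e :: es' then iter e burge (fun L M => fermi es' M L) L M else (M == 0%N)%:R.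

(* The bounds 2r <= p and 2s <= p' single out the least Bezout pair. *)
Definition good_labels (p p' r s : nat) : Prop :=
  [/\ (0 < p)%N, (0 < p')%N, (2 * r <= p)%N, (2 * s <= p')%N
    & `|p'%:Z * r%:Z - p%:Z * s%:Z| = 1].

Lemma good_labels_coprime p p' r s : good_labels p p' r s -> coprime p p'.
Proof.
case=> p0 p'0 _ _ bez; rewrite /coprime -dvdn1.
have : (gcdn p p' %| p'%:Z * r%:Z - p%:Z * s%:Z)%Z.
  by apply: rpredB; apply: dvdz_mulr; rewrite dvdzE /= ?dvdn_gcdl ?dvdn_gcdr.
by move: (p'%:Z * _ - _) bez => x bez; rewrite dvdzE (_ : `|x|%N = 1%N) //; lia.
Qed.

Lemma eq_iter_burge e f g L M :
  (forall L' M', (L' + M' <= L + M)%N -> f L' M' = g L' M') ->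
  iter e burge f L M = iter e burge g L M.
Proof.
elim: e L M => [|e IHe] L M fg /=; first exact: fg.
by apply: eq_burge => L' M' le; apply: IHe => ? ? le'; apply: fg; lia.
Qed.

(** Adding [(p, r)] to [(p', s)] preserves the determinant [p' r - p s] and the bounds in
    [good_labels]. *)
Lemma iter_burge_bose p p' r s e B L M : good_labels p p' r s ->
  good_labels p (p' + e * p) r (s + e * r) /\
  iter e burge (bose p p' r s B) L M = bose p (p' + e * p) r (s + e * r) B L M.
Proof.
move=> good.
have goodk k : good_labels p (p' + k * p) r (s + k * r).
  by case: good => p0 p'0 ler les bez; split; rewrite ?PoszD ?PoszM; nia.
split=> //; elim: e L M => [|e IHe] L M; first by rewrite !mul0n !addn0.
have [p0 p'0 ler les bez] := goodk e; rewrite iterS.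
transitivity (burge (bose p (p' + e * p) r (s + e * r) B) L M).
  by apply: eq_bigr => x _; rewrite IHe.
rewrite burge_bose //; try lia.
by congr bose; lia.
Qed.

(* [contfrac] with the last entry increased by 2, see [contfrac_rcons]. *)
Fixpoint contfrac2 (es : seq nat) : rat :=
  if es is e :: es' then e%:R + 1 / contfrac2 es' else 2^-1.

Lemma contfrac_rcons es e : contfrac (rcons es (e + 2)) = contfrac2 (rcons es e).
Proof.
elim: es => [|a es IHes] /=; first by rewrite natrD; field.
by rewrite -IHes; case: es {IHes}.
Qed.

(** Prepending an entry [e] to the continued fraction amounts to exchanging [L] and [M] and then
    transforming [e] times. *)
Lemma fermi_bose es : exists p p' r s,
  [/\ good_labels p p' r s, contfrac2 es = p'%:R / p%:R &
    forall B L M, (L + M < B)%N -> fermi es L M = bose p p' r s B L M].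
Proof.
elim: es => [|e es [p [p' [r [s [good cf eq_fermi]]]]]].
  exists 2%N, 1%N, 1%N, 0%N; split => // B L M ltB.
  (* The labels 2, 1, 1, 0 arise from 1, 1, 0, 1 by one transform and an exchange; in this transform
     only [x = 0] with [M = 0] survives. *)
  rewrite bose_swap; have -> : bose 1 2 0 1 B M L = burge (bose 1 1 0 1 B) M L.
    by rewrite burge_bose.
  rewrite /burge big_ord_recl big1 ?addr0 => [|[x ltx] _] /=.
    rewrite bose11; last by lia.
    rewrite subn0 eqxx andbT; case: eqP => [->|_]; last by rewrite mulr0.
    by rewrite muln0 add0n addn0 subn0 gaussnn !mulr1 expr0.
  by rewrite /bump add1n bose11 ?andbF ?mulr0 //; lia.
have goodC : good_labels p' p s r by case: good => *; split; lia.
exists p', (p + e * p')%N, s, (r + e * s)%N.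
split=> [||B L M ltB].
- by case: (iter_burge_bose e 0 0 0 goodC).
- case: good => p0 p'0 _ _ _; rewrite /= cf natrD natrM.
  have ? : p%:R != 0 :> rat by rewrite pnatr_eq0 -lt0n.
  have ? : p'%:R != 0 :> rat by rewrite pnatr_eq0 -lt0n.
  by field; apply/andP.
- have [_ <-] := iter_burge_bose e B L M goodC.
  by apply: eq_iter_burge => L' M' le; rewrite bose_swap; apply: eq_fermi; lia.
Qed.

Lemma eq_coprime_frac p p' P P' : coprime p p' -> coprime P P' -> (0 < p)%N -> (0 < P)%N ->
  p'%:R / p%:R = P'%:R / P%:R :> rat -> p = P /\ p' = P'.
Proof.
move=> co coP p0 P0 /eqP.
rewrite eqr_div ?pnatr_eq0 -?lt0n // -!natrM eqr_nat => /eqP eqM.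
have eqp : p = P.
  apply/eqP; rewrite eqn_dvd; apply/andP; split.
    by rewrite -(Gauss_dvdr P co) eqM dvdn_mull.
  by rewrite -(Gauss_dvdr p coP) -eqM dvdn_mull.
by split=> //; move: eqM; rewrite eqp => /eqP; rewrite eqn_pmul2r // => /eqP.
Qed.

(** According to the signs of the two determinants, [p] divides [r - r0] or [r + r0]. The first is
    less than [p], hence 0. The second is at most [2r <= p], so it is 0 or [p]; either way the
    bounds force [r = r0] and [s = s0]. *)
Lemma least_bezout_pair_eq p p' r s r0 s0 :
  good_labels p p' r s -> least_bezout_pair p p' r0 s0 -> r0 = r /\ s0 = s.
Proof.
move=> good [bez0 least]; have co := good_labels_coprime good.
case: good => p0 p'0 ler les bez.
have [|le_r le_s] := least r s; first by rewrite /bezout_pair -bez; lia.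
rewrite /bezout_pair in bez0.
have [eqd|eqd] : (p * (s - s0) = p' * (r - r0) \/ p * (s + s0) = p' * (r + r0))%N.
- have [] : p%:Z * s%:Z - p'%:Z * r%:Z = p%:Z * s0%:Z - p'%:Z * r0%:Z \/
    p%:Z * s%:Z - p'%:Z * r%:Z = - (p%:Z * s0%:Z - p'%:Z * r0%:Z) by lia.
    by move=> e; left; nia.
  by move=> e; right; nia.
- have : (p %| r - r0)%N by rewrite -(Gauss_dvdr _ co) -eqd dvdn_mulr.
  have [e|ne] := posnP (r - r0)%N; last by move=> /(dvdn_leq ne); lia.
  by move=> _; rewrite e muln0 in eqd; nia.
- have : (p %| r + r0)%N by rewrite -(Gauss_dvdr _ co) -eqd dvdn_mulr.
  have [e|ne] := posnP (r + r0)%N; first by rewrite e muln0 in eqd; nia.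
  by move=> /(dvdn_leq ne) le; nia.
Qed.

(** * Enumeration of the sequences of partitions *)

(** The factor collected by the iterated transform along one choice [s] of summation indices; each
    index [x] moves [(L, M)] to [(L - x, x)]. *)
Fixpoint chain_wt (L M : nat) (s : seq nat) : fps int :=
  if s is x :: s' then
    q ^+ (x ^ 2) * gauss (2 * (L - x) + M + x) (M - x) * chain_wt (L - x) x s'
  else 1.

Fixpoint chains (e L M : nat) : seq (seq nat) :=
  if e is e'.+1 then
    [seq x :: s | x <- index_iota 0 (minn L M).+1, s <- chains e' (L - x) x]
  else [:: [::]].

Arguments chains : simpl never.

Lemma chainsS e L M : chains e.+1 L M =
  [seq x :: s | x <- index_iota 0 (minn L M).+1, s <- chains e (L - x) x].
Proof. by []. Qed.

(** Bounding each index by both components of the current pair means that the parts decrease weakly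
    from [M] and that their sum stays within [L]. *)
Lemma mem_chains e L M s :
  (s \in chains e L M) = [&& size s == e, path geq M s & (sumn s <= L)%N].
Proof.
elim: e L M s => [|e IHe] L M [|x s] //; rewrite chainsS.
  by apply/negP => /allpairsPdep[x [t []]].
rewrite [RHS]/=; apply/idP/idP => [/allpairsPdep[y [t [iy]]]|].
  rewrite IHe mem_index_iota in iy * => /and3P[/eqP <- pt st] [-> ->].
  by rewrite eqxx pt; lia.
rewrite eqSS => /and3P[sz /andP[lex pt] st].
apply/allpairsPdep; exists x, s; rewrite mem_index_iota IHe sz pt; split=> //; lia.
Qed.

Lemma chains_uniq e L M : uniq (chains e L M).
Proof.
elim: e L M => // e IHe L M; rewrite chainsS; apply: allpairs_uniq_dep; rewrite ?iota_uniq //.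
by move=> [x s] [y t] _ _ /= [-> ->].
Qed.

Lemma iter_burgeE e f L M :
  iter e burge f L M =
  \sum_(s <- chains e L M) chain_wt L M s * f (L - sumn s)%N (last M s).
Proof.
elim: e L M => [|e IHe] L M; first by rewrite big_seq1 mul1r subn0.
rewrite iterS chainsS big_allpairs_dep /= /burge.
rewrite -(big_mkord xpredT (fun x => q ^+ (x ^ 2) * gauss (2 * (L - x) + M + x) (M - x) *
   iter e burge f (L - x)%N x)).
apply: eq_bigr => x _.
by rewrite IHe mulr_sumr; apply: eq_bigr => s _ /=; rewrite mulrA subnDA.
Qed.

Fixpoint multichain_wt (L M : nat) (l : seq (seq nat)) : fps int :=
  if l is s :: l' then chain_wt L M s * multichain_wt (last M s) (L - sumn s) l' else 1.

(** The arguments [last M s] and [L - sumn s] are in exchanged order, as in [fermi]. The base value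
    [(M == 0)%:R] becomes a condition on the index set, eventually [wt n = w n]. *)
Fixpoint multichains (es : seq nat) (L M : nat) : seq (seq (seq nat)) :=
  if es is e :: es' then
    [seq s :: l | s <- chains e L M, l <- multichains es' (last M s) (L - sumn s)]
  else nseq (M == 0%N) [::].

Lemma fermiE es L M : fermi es L M = \sum_(l <- multichains es L M) multichain_wt L M l.
Proof.
elim: es L M => [|e es IHes] L M /=.
  by case: eqP => _; rewrite ?big_seq1 ?big_nil.
rewrite iter_burgeE big_allpairs_dep; apply: eq_bigr => s _.
by rewrite IHes mulr_sumr.
Qed.

Lemma multichains_uniq es L M : uniq (multichains es L M).
Proof.
elim: es L M => [|e es IHes] L M /=; first by case: (M == 0%N).
apply: allpairs_uniq_dep => [||[x s] [y t] _ _ /= [-> ->]] //.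
exact: chains_uniq.
Qed.

(* The pair (L, M) with which the mu-th partition of [l] is weighted. *)
Fixpoint state (L M : nat) (l : seq (seq nat)) (mu : nat) : nat * nat :=
  if mu is mu'.+1 then
    (last (state L M l mu').2 (part l mu'), (state L M l mu').1 - wt l mu')%N
  else (L, M).

Lemma state_cons L M s l mu :
  state L M (s :: l) mu.+1 = state (last M s) (L - sumn s) l mu.
Proof.
elim: mu => // mu IHmu.
rewrite -[LHS]/(last (state L M (s :: l) mu.+1).2 (part l mu),
  (state L M (s :: l) mu.+1).1 - wt l mu)%N.
by rewrite IHmu.
Qed.

Lemma mem_multichains es L M l :
  l \in multichains es L M <->
  [/\ size l = size es,
      forall mu, (mu < size es)%N ->
        part l mu \in chains (nth 0%N es mu) (state L M l mu).1 (state L M l mu).2 &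
      (state L M l (size es)).2 = 0%N].
Proof.
elim: es L M l => [|e es IHes] L M l /=.
  split=> [|[/size0nil -> _ ->]] //.
  by rewrite mem_nseq; case: eqP => //= -> /eqP ->.
split=> [/allpairsPdep[s [l' [sin /IHes[sz lin fin] ->]]]|[]].
  split; first by rewrite /= sz.
    by case=> [_|mu ltmu] //; rewrite state_cons; exact: lin.
  by rewrite -[RHS]fin -state_cons.
case: l => // s l [sz] lin fin; apply/allpairsPdep; exists s, l.
split=> //; first exact: (lin 0%N).
apply/IHes; split=> // [mu ltmu|]; last by rewrite -state_cons.
by have := lin mu.+1 ltmu; rewrite state_cons.
Qed.

Lemma multichain_wtE L M l :
  multichain_wt L M l =
  \prod_(mu < size l) chain_wt (state L M l mu).1 (state L M l mu).2 (part l mu).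
Proof.
elim: l L M => [|s l IHl] L M; first by rewrite big_ord0.
rewrite /= big_ord_recl IHl; congr (_ * _); apply: eq_bigr => mu _.
by rewrite lift0 state_cons.
Qed.

(** Putting [M] in front of [s] numbers the parts from 1 and lets [M] act as the extra entry of
    index 0. *)
Lemma chain_wtE L M s (c := nth 0%N (M :: s)) :
  chain_wt L M s =
  q ^+ (\sum_(1 <= i < (size s).+1) c i ^ 2) *
  \prod_(1 <= i < (size s).+1)
    gauss (2 * (L - \sum_(1 <= j < i.+1) c j) + c i.-1 + c i) (c i.-1 - c i).
Proof.
rewrite {}/c; elim: s L M => [|x s IHs] L M; first by rewrite !big_geq // mulr1.
rewrite /= IHs !(big_nat_recl (size s).+1 1) //= exprD big_nat1 /=.
rewrite -!mulrA; congr (_ * _); rewrite mulrCA; congr (_ * (_ * _)).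
apply: eq_big_nat => i /andP[i0 _].
rewrite (big_nat_recl i.+1) //= subnDA.
by case: i i0.
Qed.

(** * Congruences modulo powers of q *)

Lemma fps_coef_sum (R : comNzRingType) (I : Type) (r : seq I) (F : I -> fps R) m :
  (\sum_(i <- r) F i) m = \sum_(i <- r) F i m.
Proof. by elim/big_rec2: _ => // i x y _ <-. Qed.

Lemma fps_sum_seq (R : comNzRingType) (I : choiceType) (A : set I) (r : seq I)
    (F : I -> fps R) m :
  uniq r -> (forall i, i \in r -> A i) -> (forall i, A i -> i \notin r -> F i m = 0) ->
  fps_sum A F m = (\sum_(i <- r) F i) m.
Proof.
move=> ur rA Ar; rewrite fps_coef_sum /fps_sum /= (fsbigE r) //.
rewrite big_seq_cond [RHS]big_seq; apply: eq_bigl => i.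
by case: (boolP (i \in r)) => //= ir; rewrite mem_set //; exact: rA.
Qed.

(** Limits are replaced by congruences modulo [q^(K+1)], with [L = M = N] chosen large in terms of
    [K]. *)
Definition eqmodq (K : nat) (f g : fps int) : Prop := forall m, (m <= K)%N -> f m = g m.

Section Congruence.
Variable K : nat.
Local Notation "f =q g" := (eqmodq K f g) (at level 70).

Lemma eqmodq_refl f : f =q f. Proof. by []. Qed.
Lemma eqmodq_eq f g : f = g -> f =q g. Proof. by move=> ->. Qed.
Lemma eqmodq_sym f g : f =q g -> g =q f.
Proof. by move=> fg m leK; rewrite fg. Qed.
Lemma eqmodq_trans f g h : f =q g -> g =q h -> f =q h.
Proof. by move=> fg gh m leK; rewrite fg // gh. Qed.

Lemma eqmodqB f g f' g' : f =q f' -> g =q g' -> f - g =q f' - g'.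
Proof. by move=> ff gg m leK; rewrite !fpsD !fpsN ff // gg. Qed.

Lemma eqmodqM f g f' g' : f =q f' -> g =q g' -> f * g =q f' * g'.
Proof.
move=> ff gg m leK; rewrite !fpsM; apply: eq_bigr => -[i lti] _ /=.
by rewrite ff ?gg //; lia.
Qed.

Lemma eqmodqV f g : f \is a GRing.unit -> g \is a GRing.unit -> f =q g -> f^-1 =q g^-1.
Proof.
move=> uf ug fg.
have -> : f^-1 = f^-1 * (g * g^-1) by rewrite divrr // mulr1.
apply: (@eqmodq_trans _ (f^-1 * (f * g^-1))).
  by apply: eqmodqM => //; apply: eqmodqM => //; exact: eqmodq_sym.
by rewrite mulKr.
Qed.

Lemma eqmodq_sum (I : eqType) (r : seq I) (F G : I -> fps int) :
  (forall i, i \in r -> F i =q G i) -> \sum_(i <- r) F i =q \sum_(i <- r) G i.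
Proof.
move=> FG m leK; rewrite !fps_coef_sum big_seq [RHS]big_seq.
by apply: eq_bigr => i ir; exact: FG.
Qed.

Lemma eqmodq_prod (I : eqType) (r : seq I) (F G : I -> fps int) :
  (forall i, i \in r -> F i =q G i) -> \prod_(i <- r) F i =q \prod_(i <- r) G i.
Proof.
move=> FG; rewrite big_seq [X in _ =q X]big_seq.
by elim/big_rec2: _ => // i x y ir xy; apply: eqmodqM => //; exact: FG.
Qed.

Lemma eqmodq_expr0 n f : (K < n)%N -> q ^+ n * f =q 0.
Proof. by move=> ltK m leK; rewrite fpsXnM (leq_ltn_trans leK ltK). Qed.

Lemma eqmodq_qpoch n : (K <= n)%N -> qpoch n =q qpoch_inf.
Proof. by move=> leK m lem; rewrite qpoch_infE // (leq_trans lem). Qed.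

(** In [qpoch (a + b) / (qpoch a * qpoch b)] the numerator and [qpoch a] are both congruent to
    [qpoch_inf]. *)
Lemma eqmodq_gauss a b : (K <= a)%N -> gauss (a + b) b =q (qpoch b)^-1.
Proof.
move=> leK; rewrite addnC gaussE invrM ?qpoch_unit // mulrA.
rewrite -[X in _ =q X]mul1r -(@mulrV _ qpoch_inf) ?qpoch_inf_unit //.
apply: eqmodqM => //; apply: eqmodqM; first by apply: eqmodq_qpoch; lia.
by apply: eqmodqV; rewrite ?qpoch_unit ?qpoch_inf_unit //; exact: eqmodq_qpoch.
Qed.

Lemma eqmodq_gauss_inf a b : (K <= a)%N -> (K <= b)%N -> gauss (a + b) b =q qpoch_inf^-1.
Proof.
move=> lea leb; apply: eqmodq_trans (eqmodq_gauss b lea) _.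
by apply: eqmodqV; rewrite ?qpoch_unit ?qpoch_inf_unit //; exact: eqmodq_qpoch.
Qed.

Lemma eqmodq_bprod N (a b : int) : (`|a|%N + K <= N)%N -> (`|b|%N + K <= N)%N ->
  bprod N N a b =q qpoch_inf^-1 * qpoch_inf^-1.
Proof.
move=> lea leb; rewrite /bprod.
have -> : N%:Z + a = absz (N%:Z + a)%R by lia.
have -> : N%:Z - a = absz (N%:Z - a)%R by lia.
have -> : N%:Z + N%:Z + a - b = (absz (N%:Z - b)%R + absz (N%:Z + a)%R)%N by lia.
have -> : N%:Z + N%:Z - a + b = (absz (N%:Z + b)%R + absz (N%:Z - a)%R)%N by lia.
by rewrite !gaussz_nat; apply: eqmodqM; apply: eqmodq_gauss_inf; lia.
Qed.

(** * The limit of the bosonic polynomials *)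

Section Bosonic.
Variables p p' r s : nat.
Hypothesis good : good_labels p p' r s.

(** The exponent is at least [l^2 - |l|], which exceeds [K] once [|l| > K + 1]. *)
Lemma chi_exp1_bound l : (`|chi_exp1 p p' r s l| <= K)%N -> (`|l| <= K.+1)%N.
Proof.
case: good => p0 p'0 _ _ bez; rewrite /chi_exp1.
have : 1 <= p%:Z * p'%:Z by nia.
rewrite -mulrA; move: (p%:Z * p'%:Z) => u u1.
move: (_ - _) bez => v v1 le; rewrite leqNgt; apply/negP => ltl.
have : (l ^+ 2 - `|l| <= K%:Z) by nia.
by nia.
Qed.

(** For [|l| > K + 1] the factor [l p + r] exceeds [K] in absolute value, and the other factor is
    nonzero. *)
Lemma chi_exp2_bound l : (`|chi_exp2 p p' r s l| <= K)%N -> (`|l| <= K.+1)%N.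
Proof.
case: good => p0 p'0 ler les _; rewrite /chi_exp2 => le; rewrite leqNgt; apply/negP => ltl.
have h1 : (K < `|(l * p%:Z + r%:Z)%R|)%N by nia.
have h2 : (0 < `|(l * p'%:Z + s%:Z)%R|)%N by nia.
by move: le; rewrite abszM leqNgt => /negP; apply; rewrite -[K]muln1; nia.
Qed.

Lemma chi_termE l :
  chi_term p p' r s l = q ^+ `|chi_exp1 p p' r s l|%N - q ^+ `|chi_exp2 p p' r s l|%N.
Proof.
case: good => p0 p'0 ler les bez; rewrite /chi_term.
have -> : chi_exp1 p p' r s l = `|chi_exp1 p p' r s l|%N.
  by rewrite gez0_abs // chi_exp1_ge0.
have -> : chi_exp2 p p' r s l = `|chi_exp2 p p' r s l|%N.
  by rewrite gez0_abs // chi_exp2_ge0 //; lia.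
by [].
Qed.

Lemma eqmodq_fps_sum_chi B : (K < B)%N ->
  fps_sum [set: int]%classic (chi_term p p' r s) =q zsum B (chi_term p p' r s).
Proof.
move=> ltB m leK.
pose ls : seq int := [seq i%:Z - B%:Z | i : nat <- index_iota 0 (2 * B).+1].
suff out (l : int) : l \notin ls -> chi_term p p' r s l m = 0.
  rewrite (fps_sum_seq (r := ls)) //; first by rewrite big_map big_mkord.
    by rewrite map_inj_uniq ?iota_uniq // => i j; lia.
  by move=> l _; exact: out.
move=> nl.
have ltl : (K.+1 < `|l|)%N.
  rewrite ltnNge; apply: contra nl => lel; apply/mapP; exists (absz (l + B%:Z)%R); last by lia.
  by rewrite mem_index_iota; lia.
rewrite chi_termE fpsD fpsN !fpsXn.
case: eqP => [e|_]; first by have := @chi_exp1_bound l; lia.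
by case: eqP => [e|_]; first by have := @chi_exp2_bound l; lia.
Qed.

(** Terms with exponent above [K] vanish on both sides. The others have [|l| <= K + 1], so the
    arguments of [bprod] are at most [(K + 2)(p + p')] in absolute value and [bprod] tends to
    [1 / qpoch_inf^2]. *)
Lemma eqmodq_bose B N : (K < B)%N -> (K.+2 * (p + p') + K <= N)%N ->
  qpoch_inf * bose p p' r s B N N =q chi p p' r s.
Proof.
move=> ltB leN.
have eq1 e a b : ((e <= K)%N -> (`|a|%N + K <= N)%N /\ (`|b|%N + K <= N)%N) ->
    qpoch_inf * (q ^+ e * bprod N N a b) =q qpoch_inf^-1 * q ^+ e.
  move=> le; case: (leqP e K) => [leK|ltK]; last first.
    rewrite mulrCA [X in _ =q X]mulrC.
    apply: eqmodq_trans (eqmodq_expr0 _ ltK) _.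
    by apply: eqmodq_sym; exact: eqmodq_expr0.
  have [lea leb] := le leK.
  rewrite mulrCA [X in _ =q X]mulrC; apply: eqmodqM => //.
  have -> : qpoch_inf^-1 = qpoch_inf * (qpoch_inf^-1 * qpoch_inf^-1).
    by rewrite mulrA divrr ?qpoch_inf_unit // mul1r.
  by apply: eqmodqM => //; exact: eqmodq_bprod.
rewrite /chi; apply: (@eqmodq_trans _ (qpoch_inf^-1 * zsum B (chi_term p p' r s))); last first.
  by apply: eqmodqM => //; apply: eqmodq_sym; exact: eqmodq_fps_sum_chi.
rewrite /bose /zsum !mulr_sumr; apply: eqmodq_sum => i _.
move: (i%:Z - B%:Z) => l; rewrite chi_termE !mulrBr; case: good => p0 p'0 ler les _.
rewrite /bose_term1 /bose_term2; apply: eqmodqB; apply: eq1 => le.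
- have := chi_exp1_bound le => lel.
  have : (`|l| * p <= K.+1 * p)%N /\ (`|l| * p' <= K.+1 * p')%N.
    by rewrite !leq_mul2r lel !orbT.
  by rewrite !abszM /=; lia.
- have := chi_exp2_bound le => lel.
  have : (`|l| * p <= K.+1 * p)%N /\ (`|l| * p' <= K.+1 * p')%N.
    by rewrite !leq_mul2r lel !orbT.
  have := abszM l p; have := abszM l p'; rewrite /=; lia.
Qed.

End Bosonic.

End Congruence.

(** * The limit of the fermionic sum *)

Local Arguments part : simpl never.

Section Fermionic.
Variables (K n : nat) (e : nat -> nat) (N : nat).
Hypotheses (n_gt0 : (0 < n)%N) (e_gt0 : forall mu, (mu < n)%N -> (0 < e mu)%N).
Hypotheses (e1_gt0 : (0 < e 1)%N) (N_large : (K * e 0%N + 2 * K <= N)%N).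
Local Notation "f =q g" := (eqmodq K f g) (at level 70).
Implicit Types l : seq (seq nat).

(** A part above [K] contributes a power of [q] above [q^K], so only these sequences matter; for
    them [N] is large against the weight of the first partition. *)
Definition parts_le l : bool := all (all (fun x => x <= K)%N) l.

Lemma parts_leP l mu : parts_le l -> all (fun x => x <= K)%N (part l mu).
Proof.
move=> /allP small; rewrite /part; case: (ltnP mu (size l)) => [lt|le].
  by apply: small; rewrite mem_nth.
by rewrite nth_default.
Qed.

Lemma nth_le s i : all (fun x => x <= K)%N s -> (nth 0%N s i <= K)%N.
Proof.
move=> small; case: (ltnP i (size s)) => [lt|le]; last by rewrite nth_default.
by move/all_nthP: small => /(_ 0%N i lt).
Qed.

Lemma sumn_le s : all (fun x => x <= K)%N s -> (sumn s <= K * size s)%N.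
Proof. by elim: s => //= x s IHs /andP[lex /IHs]; lia. Qed.

Lemma path_geqE M s : path geq M s = (nth 0%N s 0 <= M)%N && sorted geq s.
Proof. by case: s. Qed.

Definition sizes_ok l := size l = n.+1 /\ forall mu, (mu <= n)%N -> size (part l mu) = e mu.

(** The pair consists of [w] and the entry of index 0, except that for the partition 1 the latter is
    [N - wt l 0], which tends to infinity. Nonempty partitions make [last] independent of its
    default. *)
Lemma stateE l mu : sizes_ok l -> (mu < n)%N ->
  state N N l mu.+1 = (w e l mu.+1, if mu == 0%N then (N - wt l 0)%N else lam e l mu.+1 0).
Proof.
move=> [_ sz]; elim: mu => [|mu IHmu] ltmu.
  rewrite /= /w -(sz 0%N) // nth_last.
  by case: (part l 0) (sz 0%N isT) (e_gt0 ltmu) => [<-|x s _ _].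
rewrite -[LHS]/(last (state N N l mu.+1).2 (part l mu.+1),
  ((state N N l mu.+1).1 - wt l mu.+1))%N IHmu ?(ltnW ltmu) //=.
congr (_, _); rewrite /w /= -(sz mu.+1) 1?ltnW // nth_last.
by case: (part l mu.+1) (sz mu.+1 (ltnW ltmu)) (e_gt0 ltmu) => [<- //|x s _ _] //=.
Qed.

(** The bounds involving [N], namely those on the partition 0 and on the first part of the partition
    1, hold automatically for parts at most [K]; the other conditions correspond one to one. *)
Lemma admissible_multichains l : parts_le l ->
  admissible n e l <-> l \in multichains (mkseq e n.+1) N N.
Proof.
move=> small; split.
  case=> szl isp le_lam le_wt wt_n; apply/mem_multichains.
  have sz : sizes_ok l.
    by split=> // mu lemu; have /andP[/eqP] := isp mu lemu.
  rewrite size_mkseq; split=> // [mu ltmu|]; last first.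
    have [m def_n] : exists m, n = m.+1 by exists n.-1; rewrite prednK.
    rewrite /= {1 2}def_n stateE //; last by rewrite def_n.
    by rewrite -def_n wt_n subnn.
  have /andP[/eqP szm so] := isp mu ltmu.
  rewrite mem_chains nth_mkseq // szm eqxx path_geqE so andbT /=.
  case: mu ltmu szm so => [|mu] ltmu szm so.
    have := nth_le 0 (parts_leP 0 small); have := sumn_le (parts_leP 0 small).
    by rewrite szm /=; lia.
  rewrite stateE //=; apply/andP; split; last exact: le_wt.
  case: mu ltmu szm so => [|mu] ltmu szm so /=; last exact: le_lam.
  have := nth_le 0 (parts_leP 1 small); have := sumn_le (parts_leP 0 small).
  by rewrite (sz.2 0%N) // /wt; lia.
move=> /mem_multichains[]; rewrite size_mkseq => szl lin fin.
have inl mu : (mu <= n)%N -> [/\ size (part l mu) = e mu, sorted geq (part l mu),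
    (nth 0 (part l mu) 0 <= (state N N l mu).2)%N & (wt l mu <= (state N N l mu).1)%N].
  move=> lemu; have := lin mu lemu; rewrite nth_mkseq // mem_chains path_geqE.
  by move=> /and3P[/eqP ? /andP[? ?] ?].
have sz : sizes_ok l by split=> // mu /inl[].
split=> //.
- by move=> mu /inl[szm so _ _]; rewrite /is_partition szm eqxx.
- case=> [|[|mu]] // /andP[_ lemu]; have [_ _ + _] := inl _ lemu.
  by rewrite stateE.
- by case=> [|mu] // /andP[_ lemu]; have [_ _ _] := inl _ lemu; rewrite stateE.
have [_ _ _ le_wt] := inl n (leqnn n).
move: fin le_wt => /=.
have [m def_n] : exists m, n = m.+1 by exists n.-1; rewrite prednK.
by rewrite def_n stateE ?def_n //=; lia.
Qed.

Lemma chain_wt_large L M s : ~~ all (fun x => x <= K)%N s -> chain_wt L M s =q 0.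
Proof.
elim: s L M => //= x s IHs L M; rewrite negb_and -ltnNge => /orP[ltK|/IHs eq0].
  rewrite -mulrA; apply: eqmodq_expr0; nia.
by rewrite -[X in _ =q X](mulr0 (q ^+ (x ^ 2) * gauss (2 * (L - x) + M + x) (M - x)));
  apply: eqmodqM.
Qed.

Lemma multichain_wt_large L M l : ~~ parts_le l -> multichain_wt L M l =q 0.
Proof.
elim: l L M => //= s l IHl L M; rewrite negb_and => /orP[|] large.
  rewrite -(mul0r (multichain_wt (last M s) (L - sumn s) l)).
  by apply: eqmodqM => //; exact: chain_wt_large.
rewrite -(mulr0 (chain_wt L M s)); apply: eqmodqM => //; exact: IHl.
Qed.

Lemma summand_large l : sizes_ok l -> ~~ parts_le l -> summand n e l =q 0.
Proof.
move=> [szl sz] /allPn[s sl /allPn[x xs]]; rewrite -ltnNge => ltK.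
rewrite /summand -!mulrA; apply: eqmodq_expr0; apply: leq_trans ltK _.
have lt_mu : (index s l < n.+1)%N by rewrite -szl index_mem.
have part_s : part l (index s l) = s by rewrite /part nth_index.
rewrite (bigD1_seq (index s l)) ?iota_uniq ?mem_index_iota //=.
apply: leq_trans (leq_addr _ _).
have lt_i : (index x s < e (index s l))%N by rewrite -sz // part_s index_mem.
rewrite (bigD1_seq (index x s).+1) ?iota_uniq ?mem_index_iota ?ltnS ?lt_i //=.
apply: leq_trans (leq_addr _ _).
by rewrite part_s nth_index //; nia.
Qed.

(** In the first Gaussian both [N - s_1] and its complement are large, giving [1 / qpoch_inf]; in
    the others the lower entry stays bounded. *)
Lemma chain_wt_top s : (0 < size s)%N -> all (fun x => x <= K)%N s -> sorted geq s ->
  (K * size s + 2 * K <= N)%N ->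
  chain_wt N N s =q q ^+ (\sum_(1 <= i < (size s).+1) nth 0%N s i.-1 ^ 2) *
    (qpoch_inf^-1 *
     \prod_(2 <= i < (size s).+1) (qpoch (nth 0%N s i.-2 - nth 0%N s i.-1))^-1).
Proof.
move=> s_gt0 small so leN; rewrite chain_wtE [X in _ * X]big_ltn //.
apply: eqmodqM.
  by apply: eqmodq_eq; congr (q ^+ _); apply: eq_big_nat => -[|i].
have nthK i := nth_le i small.
apply: eqmodqM.
  rewrite big_nat1 /=; have := nthK 0%N => le0.
  have -> : (2 * (N - nth 0 s 0) + N + nth 0 s 0 =
    (2 * (N - nth 0 s 0) + nth 0 s 0 + nth 0 s 0) + (N - nth 0 s 0))%N by lia.
  by apply: eqmodq_gauss_inf; lia.
apply: eqmodq_prod => -[|[|i]]; rewrite mem_index_iota //= ltnS => lti.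
have le_i : (nth 0 s i.+1 <= nth 0 s i)%N.
  by have /(sortedP 0%N)/(_ i) := so; apply.
(* The index [j = 0], where the entry is [N], is outside the range, so every summand is a part. *)
have le_sum : (\sum_(1 <= j < i.+3) nth 0 (N :: s) j <= K * size s)%N.
  apply: (@leq_trans (\sum_(1 <= j < i.+3) K)).
    by rewrite big_nat_cond [leqRHS]big_nat_cond; apply: leq_sum => -[|j] //= _; exact: nthK.
  by rewrite sum_nat_const_nat; nia.
have -> : (2 * (N - \sum_(1 <= j < i.+3) nth 0 (N :: s) j) + nth 0 s i + nth 0 s i.+1 =
   (2 * (N - \sum_(1 <= j < i.+3) nth 0 (N :: s) j) + nth 0 s i.+1 + nth 0 s i.+1)
   + (nth 0 s i - nth 0 s i.+1))%N by lia.
by apply: eqmodq_gauss; lia.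
Qed.

(** Here only [M] is large. The first Gaussian equals [[(M - x) + 2L; 2L]] and tends to
    [1 / qpoch (2 * L)]; this is why the product for [mu = 1] starts at [i = 2]. *)
Lemma chain_wt_second L M s (c := fun i => nth 0%N s i.-1) :
  (0 < size s)%N -> all (fun x => x <= K)%N s -> (2 * K <= M)%N -> (sumn s <= L)%N ->
  chain_wt L M s =q q ^+ (\sum_(1 <= i < (size s).+1) c i ^ 2) *
    ((qpoch (2 * L))^-1 *
     \prod_(2 <= i < (size s).+1)
       gauss (2 * (L - \sum_(1 <= j < i.+1) c j) + c i.-1 + c i) (c i.-1 - c i)).
Proof.
rewrite {}/c => s_gt0 small leM leL; rewrite chain_wtE [X in _ * X]big_ltn //.
apply: eqmodqM.
  by apply: eqmodq_eq; congr (q ^+ _); apply: eq_big_nat => -[|i].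
apply: eqmodqM; last first.
  apply: eqmodq_eq; apply: eq_big_nat => -[|[|i]] //= _.
  congr (gauss (2 * (_ - _) + _ + _) _).
  by apply: eq_big_nat => -[|j].
rewrite big_nat1; case: s s_gt0 small leL => //= x s _ /andP[lex _] leL.
have -> : (2 * (L - x) + M + x = (M - x) + 2 * L)%N by lia.
rewrite -[X in gauss _ X](addnK (2 * L)%N (M - x)%N) gauss_sym ?leq_addl //.
by apply: eqmodq_gauss; lia.
Qed.

(** Only the partitions 0 and 1 involve [N]; for [mu >= 2] the factors agree exactly. *)
Lemma eqmodq_summand l : admissible n e l -> parts_le l ->
  qpoch_inf * multichain_wt N N l =q summand n e l.
Proof.
move=> adm small; have [szl isp le_lam le_wt _] := adm.
have szp mu : (mu <= n)%N -> size (part l mu) = e mu.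
  by move=> lemu; have /andP[/eqP] := isp mu lemu.
have sz : sizes_ok l by split.
pose E mu := (\sum_(1 <= i < (e mu).+1) lam e l mu i ^ 2)%N.
pose P i0 mu := \prod_(i0 <= i < (e mu).+1)
  gauss (2 * (w e l mu - \sum_(1 <= j < i.+1) lam e l mu j) + lam e l mu i.-1 + lam e l mu i)
        (lam e l mu i.-1 - lam e l mu i).
have -> : summand n e l =
  (q ^+ E 0%N * \prod_(2 <= i < (e 0%N).+1) (qpoch (lam e l 0 i.-1 - lam e l 0 i))^-1) *
  (q ^+ E 1%N * ((qpoch (2 * w e l 1))^-1 * P 2%N 1%N)) *
  \prod_(2 <= mu < n.+1) (q ^+ E mu * P 1%N mu).
  rewrite /summand (@big_ltn _ _ _ 0 n.+1) // !(@big_ltn _ _ _ 1 n.+1) //.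
  rewrite -/(E 0%N) -/(E 1%N) -/(P 2%N 1%N) -/(\sum_(2 <= mu < n.+1) E mu)%N.
  rewrite !exprD big_split (big_morph (fun k => q ^+ k) (exprD q) (expr0 q)).
  have -> : \prod_(2 <= mu < n.+1) \prod_(1 + (mu == 1%N) <= i < (e mu).+1)
      gauss (2 * (w e l mu - \sum_(1 <= j < i.+1) lam e l mu j) + lam e l mu i.-1 + lam e l mu i)
        (lam e l mu i.-1 - lam e l mu i) = \prod_(2 <= mu < n.+1) P 1%N mu.
    by apply: eq_big_nat => -[|[|mu]].
  (* The denominator [qpoch (2 * lam 0 (e 0))] is the one produced by the partition 1, whose first
     component is [w 1]. *)
  have -> : lam e l 0 (e 0%N) = w e l 1.
    by rewrite /w /=; case: (e 0%N) (e_gt0 n_gt0).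
  rewrite [in RHS]/=; ring.
rewrite multichain_wtE szl.
rewrite -(big_mkord xpredT (fun mu => chain_wt (state N N l mu).1 (state N N l mu).2 (part l mu))).
rewrite (@big_ltn _ _ _ 0 n.+1) // (@big_ltn _ _ _ 1 n.+1) // 2!mulrA.
apply: eqmodqM; last first.
  apply: eqmodq_eq; apply: eq_big_nat => -[|[|mu]] // /andP[_ ltmu].
  rewrite stateE //= chain_wtE szp //; congr (q ^+ _ * _).
    by apply: eq_big_nat => -[|i].
  apply: eq_big_nat => -[|i] // _.
  congr (gauss (2 * (_ - _) + _ + _) (_ - _)); try by case: i.
  by apply: eq_big_nat => -[|j].
have /andP[_ so0] := isp 0%N isT.
apply: eqmodqM; last first.
  rewrite stateE //= -/(w e l 1).
  have := @chain_wt_second (w e l 1) (N - wt l 0) (part l 1).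
  rewrite szp // => H; apply: eqmodq_trans (H _ _ _ _) _ => //.
  - exact: parts_leP.
  - by have := sumn_le (parts_leP 0 small); rewrite szp // /wt; lia.
  - exact: le_wt.
  apply: eqmodq_eq; congr (q ^+ _ * (_ * _)).
    by apply: eq_big_nat => -[|i].
  apply: eq_big_nat => -[|[|i]] //= _.
  congr (gauss (2 * (_ - _) + _ + _) (_ - _)).
  by apply: eq_big_nat => -[|j].
rewrite /=; have := @chain_wt_top (part l 0); rewrite szp // => H.
apply: (@eqmodq_trans _ _ (qpoch_inf * _) _ (eqmodqM (@eqmodq_refl K qpoch_inf) (H _ _ _ _))) => //.
- exact: e_gt0.
- exact: parts_leP.
(* The prefactor [qpoch_inf] cancels the limit of the very first Gaussian. *)
apply: eqmodq_eq; rewrite mulrCA [qpoch_inf * (_ * _)]mulrA divrr ?qpoch_inf_unit // mul1r.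
congr (q ^+ _ * _); first by apply: eq_big_nat => -[|i].
by apply: eq_big_nat => -[|[|i]].
Qed.

Lemma eqmodq_fermi :
  qpoch_inf * fermi (mkseq e n.+1) N N =q fps_sum [set l | admissible n e l]%classic (summand n e).
Proof.
move=> m lem; pose ls := [seq l <- multichains (mkseq e n.+1) N N | parts_le l].
rewrite (fps_sum_seq (r := ls)); first last.
- move=> l adm nl.
  have large : ~~ parts_le l.
    apply: contra nl => small; rewrite mem_filter small.
    by apply/(admissible_multichains small).
  rewrite summand_large //; case: adm => szl isp _ _ _; split=> // mu lemu.
  by have /andP[/eqP] := isp mu lemu.
- by move=> l; rewrite mem_filter => /andP[small /(admissible_multichains small)].
- by rewrite filter_uniq // multichains_uniq.
rewrite fermiE mulr_sumr big_filter [in RHS]big_mkcond; move: m lem.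
rewrite -/(eqmodq K _ _). apply: eqmodq_sum => l lin; case: ifP => [small|/negbT large].
  by apply: eqmodq_summand => //; apply/(admissible_multichains small).
rewrite -[X in _ =q X](mulr0 qpoch_inf); apply: eqmodqM => //.
exact: multichain_wt_large.
Qed.

End Fermionic.

(** * The shape of the continued fraction, and the theorem *)

Lemma contfrac2_gt0 es : 0 < contfrac2 es.
Proof.
elim: es => //= e es IHes; rewrite addrC ltr_wpDr ?ler0n //.
by rewrite div1r invr_gt0.
Qed.

(* The first two partitions need a nonempty index set: an empty one would mean
   p' < p or p <= 2. *)
Lemma contfrac2_shape p p' n e : (2 < p)%N -> (p < p')%N -> coprime p p' ->
  contfrac2 (mkseq e n.+1) = p'%:R / p%:R ->
  (forall mu, (0 < mu < n)%N -> (0 < e mu)%N) ->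
  [/\ (0 < n)%N, (0 < e 1)%N & (0 < e 0)%N].
Proof.
move=> p_gt2 ltpp' co.
(* The cases [n = 0], and [n = 1] with [e 1 = 0], would make [p' / p] half an integer, which is
   impossible for [p > 2] coprime to [p']. *)
have not_dvd : ~~ (p %| 2 * p')%N.
  by rewrite Gauss_dvdl //; apply/negP => /dvdn_leq; lia.
have dvd_half k : k%:R / 2 = p'%:R / p%:R :> rat -> (p %| 2 * p')%N.
  move/eqP; rewrite eqr_div ?pnatr_eq0 //; last by lia.
  by rewrite -!natrM eqr_nat mulnC => /eqP eqk; rewrite mulnC -eqk dvdn_mulr.
case: n => [|n] cf e_gt0.
  case/negP: not_dvd; apply: (dvd_half (2 * e 0%N + 4)%N).
  by rewrite -cf /= natrD natrM; field.
have e1_gt0 : (0 < e 1%N)%N.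
  case: n cf e_gt0 => [|n] cf e_gt0; last exact: e_gt0.
  rewrite lt0n; apply/negP => /eqP e1.
  case/negP: not_dvd; apply: (dvd_half (2 * e 0%N + 1)%N).
  by rewrite -cf /= e1 natrD natrM; field.
split=> //; rewrite lt0n; apply/negP => /eqP e0.
have gt1 : 1 < p'%:R / p%:R :> rat.
  by rewrite ltr_pdivlMr ?ltr0n ?mul1r ?ltr_nat //; lia.
move: gt1; rewrite -cf /mkseq /= e0 add0r div1r.
set c := contfrac2 _; have c_gt0 : 0 < c := contfrac2_gt0 _.
have e1_ge1 : 1 <= (e 1%N)%:R :> rat by rewrite ler1n.
have d_gt0 : 0 < 1 / c by rewrite div1r invr_gt0.
by rewrite invf_gt1; lra.
Qed.

Theorem theorem5p5 (p p' : nat) (p_gt2 : (2 < p)%N) (lt_pp' : (p < p')%N)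
  (co_pp' : coprime p p')
  (r0 s0 : nat) (rs0P : least_bezout_pair p p' r0 s0)
  (n : nat) (e : nat -> nat)
  (cfP : has_contfrac (p'%:R / p%:R) (rcons (mkseq e n) (e n + 2)%N)) :
  chi p p' r0 s0 = fps_sum [set l | admissible n e l] (summand n e).
Proof.
have mkseqS : mkseq e n.+1 = rcons (mkseq e n) (e n) by rewrite /mkseq -addn1 iotaD map_cat cats1.
have [P [P' [r [s [good cf eqf]]]]] := fermi_bose (mkseq e n.+1).
case: cfP; rewrite contfrac_rcons -mkseqS cf => eq_frac e_pos _.
have [P0 P'0 _ _ _] := good.
have [||eqp eqp'] := eq_coprime_frac (good_labels_coprime good) co_pp' _ _ eq_frac; try lia.
subst P P'; have [-> ->] := least_bezout_pair_eq good rs0P.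
have e_gt0 mu : (0 < mu < n)%N -> (0 < e mu)%N.
  case: mu => // mu ltmu; have ltn' : (mu.+1 < n)%N by [].
  move/all_nthP: e_pos => /(_ 0%N mu).
  rewrite size_behead size_rcons size_mkseq nth_behead nth_rcons size_mkseq ltn' nth_mkseq //.
  by apply; lia.
have [n_gt0 e1_gt0 e0_gt0] := contfrac2_shape p_gt2 lt_pp' co_pp' cf e_gt0.
apply/fpsP => K.
(* The first two summands serve [eqmodq_fermi], the last, with one [K], serves [eqmodq_bose]; the
   cutoff [(K + 2 * N).+1] exceeds both [K] and [L + M = 2 * N]. *)
pose N := (K * e 0%N + 2 * K + K.+2 * (p + p'))%N.
transitivity ((qpoch_inf * bose p p' r s (K + 2 * N).+1 N N) K).
  by apply/esym/(eqmodq_bose good _ _ (leqnn K)); lia.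
rewrite -eqf; last by lia.
apply: (eqmodq_fermi n_gt0 _ e1_gt0 _ (leqnn K)); last by lia.
by case=> [|mu] ltmu //; exact: e_gt0.
Qed.
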